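(* As $k\to\infty$, $$d_2(2^k-3)\ \sim\ \frac{2^k}{5k\log 2}\,(1+\bar\Theta_k),$$ where $\bar\Theta_k$ is a bounded oscillating function of $k$ with $|\bar\Theta_k|<10^{-5}$.
   Context: Nonnegative integers are written in base $2$ with digits $0,1$: $n=n_{k-1}\ldots n_0|_2$ denotes $\sum_i n_i2^i$. The base $2$ dismal product of $m=m_{k-1}\ldots m_0|_2$ and $n=n_{l-1}\ldots n_0|_2$ is the number $m\otimes_2 n$ whose $i$-th binary digit, $0\le i\le k+l-2$, is $\max\{\min\{m_j,n_{i-j}\}:0\le j\le k-1,\ 0\le i-j\le l-1\}$ (OR of ANDs, no carries). A number $p$ is a base $2$ dismal divisor of $n$ if $p\otimes_2 q=n$ for some nonnegative integer $q$; $d_2(n)$ is the number of base $2$ dismal divisors of $n$. Here $\log$ is the natural logarithm, $a_k\sim b_k$ means $a_k/b_k\to1$, and ''oscillating'' means that $\bar\Theta_k$ fluctuates with $k$ and, though small, does not tend to zero. *)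

(* Defs.v *)
From mathcomp Require Import all_boot all_order all_algebra finmap.
From mathcomp Require Import all_classical all_reals all_analysis.

Set Implicit Arguments.
Unset Strict Implicit.
Unset Printing Implicit Defensive.

Import Order.TTheory GRing.Theory Num.Theory numFieldNormedType.Exports.

Local Open Scope classical_set_scope.

Definition digit2 (n i : nat) : nat := (n %/ 2 ^ i) %% 2.

(* [trunc_log 2 0 = 0], so 0 has the single digit 0. *)
Definition length2 (n : nat) : nat := (trunc_log 2 n).+1.

Definition dismal_digit2 (m n i : nat) : nat :=
  \max_(j < length2 m | (j <= i) && (i - j < length2 n))
     minn (digit2 m j) (digit2 n (i - j)).

Definition dismal_mul2 (m n : nat) : nat :=
  \sum_(i < (length2 m + length2 n).-1) dismal_digit2 m n i * 2 ^ i.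

Definition dismal_dvd2 (p n : nat) : Prop :=
  exists q : nat, dismal_mul2 p q = n.

(* For n > 0 every divisor is at most n, so the set is finite and this is its
   cardinality; every number divides 0, where the value is the junk value 0. *)
Definition d2 (n : nat) : nat := #|` fset_set [set p | dismal_dvd2 p n]|.

(* Bounded without a limit; in particular such a sequence is neither eventually
   constant nor convergent to 0. *)
Definition oscillating (R : realType) (u : nat -> R) : Prop :=
  bounded_fun u /\ ~ cvgn u.

(* Main.v *)
Require Import Defs.
From Stdlib Require Import ZArith.
From mathcomp Require Import all_boot all_order all_algebra finmap.
From mathcomp Require Import all_classical all_reals all_analysis.
From mathcomp Require Import zify ssrZ ring lra.

Import Order.TTheory GRing.Theory Num.Theory numFieldNormedType.Exports.

Set Implicit Arguments.
Unset Strict Implicit.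
Unset Printing Implicit Defensive.

Local Open Scope classical_set_scope.
Local Open Scope ring_scope.

(** A number [p] divides [n = 2 ^ k - 3], all of whose [k] digits are one except
digit 1, when some [q] fills exactly the positions [i < k], [i != 1].  Either
[p = n], or [p] and [q] are odd with digit 1 zero; filling is monotone in [q], so
given the length [l > 2] of [q] the largest candidate [q = 2 ^ l - 3] works as
soon as any does ([dismal_dvd2_target]).  The condition that remains is a regular one
on the digits of [p]: every position has a one of [p] at distance 0 or 2, ..., [l - 1]
below it.  Zero runs of length [l] are thus forbidden, and a run of length [l - 2] or
[l - 1] must be followed by two ones.  An automaton checks this ([state_inv],
[state0_iff]), which turns [d2 (2 ^ k - 3)] into a sum over [l] of numbers of accepted
words ([d2_target]).

For a fixed [l] the accepted words of length [n] are the compositions of [n] into the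
parts 1, ..., [l - 2], [l], [l + 1].  Their number [C n] satisfies a recurrence with
few terms ([C_rec]), from which [C n / 2 ^ n] is seen to shrink at each step by the
factor [1 - 5 / 2 ^ (l + 2)], up to a relative error of order [l / 2 ^ l]
in the loss ([regularity_sharp]).
With [psi s = s * exp (- s)], the cofactor length [l] therefore contributes
[psi (5 * k / 2 ^ (l + 2))] to [5 * k * d2 (2 ^ k - 3) / 2 ^ k], up to an error of
order [l / k] ([term_error]).  The estimate needs [l >= 8]; for smaller [l] both sides
decay with [k] ([accepted_decay]), and for [l] above [2 * log2 k] both are
trivially small.  Altogether the scaled count differs from
the sum of these values over [3 <= l <= k] by [O((log k) ^ 2 / k)]
([scaled_d2_error]).

That sum is, up to negligible tails, the sum of [psi (x * 2 ^ j)] over all integers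
[j], where [1 <= x < 2] is the mantissa of [5 * k].  As a function of [log2 x] it
is periodic with mean [1 / ln 2], and its first Fourier mode has relative amplitude
[2 * |Gamma (1 + 2 * pi * i / ln 2)|], about [9.884e-6].  This is so close to [1e-5] that
the bound is obtained by evaluation: the sum is enclosed at 2049 equidistant
points of [[1, 2]] by integer arithmetic ([grid_test_all]), extended to all [x] by a
bound on [psi''] ([core_bounds]), completed by bounds on the tails
([dyadic_sum_core]) and compared with an enclosure of [ln 2] ([dyadic_sum_ln2]).
Along [k = 2 ^ e] the mantissa is 5/4 and along [k = 3 * 2 ^ e] it is 15/8; the two
values lie near opposite extremes, so the fluctuation has no limit
([fluctuation_osc]). *)

(** * Binary digits and dismal divisors *)

Section Divisors.
Local Open Scope nat_scope.

Definition bit n i : bool := odd (n %/ 2 ^ i).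

Lemma digit2E n i : digit2 n i = bit n i.
Proof. by rewrite /digit2 modn2. Qed.

Lemma length2_lt n : n < 2 ^ length2 n.
Proof. by rewrite /length2; case: n => [|n] //; apply: trunc_log_ltn. Qed.

Lemma bit_ge n i : length2 n <= i -> bit n i = false.
Proof.
move=> ni; rewrite /bit divn_small //.
by apply: leq_trans (length2_lt n) _; rewrite leq_exp2l.
Qed.

Lemma bit_top n : 0 < n -> bit n (length2 n).-1.
Proof.
move=> n0; rewrite /bit /length2 /=.
have /andP[A B] := trunc_log_bounds (isT : 1 < 2) n0.
have -> : n %/ 2 ^ trunc_log 2 n = 1; last by [].
apply/eqP; rewrite eqn_leq -ltnS ltn_divLR ?expn_gt0 // mulnC -expnSr B.
by rewrite leq_divRL ?expn_gt0 // mul1n A.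
Qed.

Lemma bit0 n : bit n 0 = odd n. Proof. by rewrite /bit divn1. Qed.
Lemma bitS n i : bit n i.+1 = bit n./2 i.
Proof. by rewrite /bit -divn2 -divnMA -expnS. Qed.

Lemma bits_recl (d : nat -> bool) N :
  \sum_(j < N.+1) d j * 2 ^ j = d 0 + (\sum_(j < N) d j.+1 * 2 ^ j).*2.
Proof.
rewrite big_ord_recl muln1; congr (_ + _).
rewrite -mul2n big_distrr /=; apply: eq_bigr => j _.
by rewrite /bump /= add1n expnS mulnCA.
Qed.

Lemma bit_sum (d : nat -> bool) N i :
  bit (\sum_(j < N) d j * 2 ^ j) i = (i < N) && d i.
Proof.
elim: i N d => [|i IH] [|N] d.
- by rewrite big_ord0.
- by rewrite bit0 bits_recl oddD odd_double addbF oddb.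
- by rewrite big_ord0 bitS; have := IH 0 (fun j => d j.+1); rewrite big_ord0.
- by rewrite bits_recl bitS half_bit_double (IH N (fun j => d j.+1)).
Qed.

Lemma eq_bits m n : (forall i, bit m i = bit n i) -> m = n.
Proof.
elim/ltn_ind: m n => m IH n mn.
have o : odd m = odd n by rewrite -!bit0.
have [m0|m0] := posnP m.
  have [//|n0] := posnP n; first by rewrite m0.
  by have := bit_top n0; rewrite -mn m0 /bit div0n.
rewrite -(odd_double_half m) -(odd_double_half n) o (IH m./2 _ n./2) //.
  lia.
by move=> i; rewrite -!bitS.
Qed.

Lemma bit_target k i : 2 < k -> bit (2 ^ k - 3) i = (i < k) && (i != 1).
Proof.
move=> k2; pose d j := j != 1.
have -> : 2 ^ k - 3 = \sum_(j < k) d j * 2 ^ j; last by rewrite bit_sum.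
rewrite -[k in RHS]prednK ?(ltnW (ltnW k2)) // -[k.-1 in RHS]prednK; last lia.
rewrite !bits_recl (bits_recl (fun j => d j.+1)).
have -> : \sum_(j < k.-2) d j.+2 * 2 ^ j = (2 ^ k.-2).-1.
  by rewrite predn_exp mul1n; apply: eq_bigr => j _; rewrite mul1n.
have -> : 2 ^ k = 4 * 2 ^ k.-2 by rewrite -(expnD 2 2); congr (_ ^ _); lia.
have : 1 < 2 ^ k.-2 by rewrite -{1}(expn0 2) ltn_exp2l; lia.
rewrite /=; lia.
Qed.

(** The OR of ANDs in one digit of a product: some one of [a] and some one of [b] have
positions adding up to [i]. *)
Definition covers (a b : nat -> bool) i := exists2 j, j <= i & a j && b (i - j).

Lemma dismal_digit2P p q i : 
  dismal_digit2 p q i = `[< covers (bit p) (bit q) i >].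
Proof.
rewrite /dismal_digit2; case: asboolP => [[j ji /andP[pj qj]]|H].
  have jp : j < length2 p by rewrite ltnNge; apply: contraL pj => /bit_ge ->.
  have jq : i - j < length2 q by rewrite ltnNge; apply: contraL qj => /bit_ge ->.
  apply/eqP; rewrite eqn_leq; apply/andP; split.
    by apply/bigmax_leqP => j' _; rewrite !digit2E geq_min; case: (bit p j').
  apply: leq_trans (leq_bigmax_cond (Ordinal jp) _); rewrite /= ?ji ?jq //.
  by rewrite !digit2E pj qj.
apply/eqP; rewrite -leqn0; apply/bigmax_leqP => j /andP[ji _].
rewrite !digit2E; case pj: (bit p j) => //; case qj : (bit q (i - j)) => //.
by exfalso; apply: H; exists j => //; rewrite pj qj.
Qed.

Lemma bit_dismal_mul2 p q i : bit (dismal_mul2 p q) i =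
  (i < (length2 p + length2 q).-1) && `[< covers (bit p) (bit q) i >].
Proof.
rewrite /dismal_mul2; under eq_bigr do rewrite dismal_digit2P.
exact: (bit_sum (fun i => `[< covers (bit p) (bit q) i >])).
Qed.

Lemma length2_eq n L : 0 < L -> bit n L.-1 -> (forall i, L <= i -> bit n i = false) ->
  length2 n = L.
Proof.
move=> L0 top big; have n0 : 0 < n.
  by case: n top {big} => [|n] //; rewrite /bit div0n.
apply/eqP; rewrite eqn_leq; apply/andP; split; rewrite leqNgt; apply/negP => H.
  by have := bit_top n0; rewrite big //; lia.
by rewrite bit_ge in top => //; lia.
Qed.

Lemma length2_target k : 2 < k -> length2 (2 ^ k - 3) = k.
Proof.
move=> k2; apply: length2_eq; rewrite ?(ltnW (ltnW k2)) //.
  by rewrite bit_target //; lia.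
by move=> i ki; rewrite bit_target // ltnNge ki.
Qed.

(** Coverage of [i] by [a] and the digits of [2 ^ l - 3]: the distances allowed
are 0 and 2, ..., [l - 1]. *)
Definition reached l (a : nat -> bool) i :=
  exists2 j, j <= i & [&& a j, i - j < l & i - j != 1].

Lemma bit1 i : bit 1 i = (i == 0).
Proof. by case: i => [|i] //; rewrite bitS /= /bit div0n. Qed.

(** Digit 0 of the product makes [p] and the cofactor [q] odd, and then digit 1 makes
both their digits 1 vanish, so every one of [q] is a one of [2 ^ l - 3], [l] the length
of [q].  Replacing [q] by [2 ^ l - 3] only adds ones to the product, and none at
position 1.  The cofactor length [l = 1] gives [p = 2 ^ k - 3], and [l = 2] is
impossible as the top digit of [q] would be its digit 1. *)
Lemma dismal_dvd2_target k p : 2 < k ->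
  dismal_dvd2 p (2 ^ k - 3) <->
  p = 2 ^ k - 3 \/ exists l, [/\ 2 < l, length2 p + l = k.+1, bit p 0 && ~~ bit p 1
     & forall i, i < k -> i != 1 -> reached l (bit p) i].
Proof.
move=> k2; split=> [[q pq]|].
- have E i : (i < (length2 p + length2 q).-1) && `[< covers (bit p) (bit q) i >]
     = (i < k) && (i != 1) by rewrite -bit_target // -pq bit_dismal_mul2.
  have [p0 q0] : bit p 0 /\ bit q 0.
    have := E 0; rewrite (ltnW (ltnW k2)) => /andP[_ /asboolP[j]].
    by rewrite leqn0 => /eqP-> /andP[].
  have posb n : bit n 0 -> 0 < n by case: n => [|n] //; rewrite /bit div0n.
  have len : (length2 p + length2 q).-1 = k.
    (* The top ones of [p] and [q] meet, so the product has its full length. *)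
    have tp := bit_top (posb _ p0); have tq := bit_top (posb _ q0).
    apply/eqP; rewrite eqn_leq; apply/andP; split.
      have := E (length2 p + length2 q).-2.
      have -> : `[< covers (bit p) (bit q) (length2 p + length2 q).-2 >].
        apply/asboolP; exists (length2 p).-1; first by rewrite /length2; lia.
        rewrite tp /=; have -> // : (length2 p + length2 q).-2 - (length2 p).-1 = (length2 q).-1.
        by rewrite /length2; lia.
      by rewrite andbT /length2; lia.
    by have := E k.-1; lia.
  have nc : ~ covers (bit p) (bit q) 1.
    by move=> /asboolP c; have := E 1; rewrite c len andbF andbT; lia.
  have p1 : ~~ bit p 1 by apply/negP => p1; apply: nc; exists 1; rewrite ?p1.
  have q1 : ~~ bit q 1 by apply/negP => q1; apply: nc; exists 0; rewrite ?p0.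
  have R i : i < k -> i != 1 -> reached (length2 q) (bit p) i.
    move=> ik i1; have := E i; rewrite ik i1 => /andP[_ /asboolP[j ji /andP[pj qj]]].
    exists j => //; rewrite pj /=; apply/andP; split.
      by rewrite ltnNge; apply: contraL qj => /bit_ge ->.
    by apply: contraNneq q1 => <-.
  have [l2|l2] := ltnP 2 (length2 q).
    by right; exists (length2 q); split => //; rewrite ?p0 // -len /length2; lia.
  left; have lq : length2 q = 1.
    have [//|ne] := eqVneq (length2 q) 1.
    have e : length2 q = 2 by move: ne l2; rewrite /length2; lia.
    by have := bit_top (posb _ q0); rewrite e (negbTE q1).
  apply: eq_bits => i; rewrite bit_target //.
  have [ik|ki] /= := ltnP i k; last by rewrite bit_ge //; move: len; rewrite lq; lia.
  have [->|i1] /= := eqVneq i 1; first exact/negbTE.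
  have [j ji /and3P[pj]] := R i ik i1; rewrite lq => ij _.
  by have -> : i = j by lia.
case=> [->|[l [l2 lp /andP[p0 p1] R]]].
- exists 1; apply: eq_bits => i; rewrite bit_dismal_mul2 length2_target // addn1 /=.
  rewrite !bit_target //; case: (ltnP i k) => //= ik.
  apply/asboolP/idP => [[j ji /andP[]]|i1].
    rewrite bit_target // bit1 => /andP[_ j1] /eqP ij.
    by have -> : i = j by lia.
  by exists i => //; rewrite bit_target // ik i1 subnn.
exists (2 ^ l - 3); apply: eq_bits => i.
rewrite bit_dismal_mul2 length2_target // lp /= bit_target //.
case: (ltnP i k) => //= ik; apply/asboolP/idP => [[j ji /andP[pj]]|i1].
  rewrite bit_target // => /andP[jl ij1]; apply/eqP => i1.
  case: j ji pj jl ij1 => [|[|j]]; rewrite ?i1 // => _ pj _ _.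
  by rewrite pj in p1.
have [j ji /and3P[pj jl ij]] := R i ik i1.
by exists j => //; rewrite pj bit_target // jl ij.
Qed.

End Divisors.

(** * The automaton that reads a divisor *)

Section Automaton.
Local Open Scope nat_scope.

(** A state [z < l] is the length of the current run of zeros, the position above the
last one being already covered from below, or exempt.  State [l] means that the last digit is a
one preceded by [l - 2] or [l - 1] zeros: the position just above it is at distance 1
from this one and at least [l] from the one before, so that it has to be a one itself.
State [l + 1] is the dead state. *)
Definition step l z b :=
  if l <= z then (if b && (z == l) then 0 else l.+1)
  else if b then (if z.+2 < l then 0 else l)
  else if z.+1 < l then z.+1 else l.+1.

(** Digit 0 is not read: the start state 0 already records it as a one. *)
Fixpoint state l (a : nat -> bool) t := if t is t'.+1 then step l (state l a t') (a t) else 0.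

(** Correctness of the automaton, by induction on [t].  The last clause for [z = 0] says
that the position above the current one is within reach of an earlier one (or is
the exempt position 1); it is what lets a zero be read next. *)
Lemma state_inv l (a : nat -> bool) t : 2 < l -> a 0 ->
  let z := state l a t in
  [/\ z < l -> [/\ z <= t, a (t - z), forall j, t - z < j <= t -> ~~ a j &
        z = 0 -> t = 0 \/ exists2 j, j < t <= j + l - 2 & a j],
      z = l -> [/\ 0 < t, a t & forall j, j < t -> a j -> j + l - 2 < t],
      z <= l -> forall i, i <= t -> i != 1 -> reached l a i &
      l < z -> exists2 i, i <= t & i != 1 /\ ~ reached l a i].
Proof.
move=> l2 a0; elim: t => [|t IH] /=.
  split; [|lia| |lia].
    by move=> _; split => //; [lia | left].
  move=> _ i i0 _; exists 0 => //; rewrite a0 /=; lia.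
move: (state l a t) IH => z [I1 I2 I3 I4].
have R1 i : a i -> reached l a i by move=> ai; exists i; rewrite ?ai ?subnn //=; lia.
have Rle : (z <= l -> reached l a t.+1 \/ t.+1 = 1) -> z <= l ->
    forall i, i <= t.+1 -> i != 1 -> reached l a i.
  move=> H zl i; rewrite leq_eqVlt => /predU1P[->|it] i1.
    by case: (H zl) => // e; rewrite e in i1.
  exact: I3 zl i it i1.
rewrite /step; case: (ltngtP l z) => [lz|zl|lz] /=; rewrite ?andbF ?andbT.
- split; [lia|lia|lia|move=> _].
  by have [i it P] := I4 lz; exists i => //; apply: leq_trans it _.
- have [z0 az gap short] := I1 zl.
  case b: (a t.+1).
    case: (ltnP z.+2 l) => zl2.
      split; [|lia| |lia].
        move=> _; split => //; rewrite ?subn0 //; first by move=> j; lia.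
        by move=> _; right; exists (t - z) => //; lia.
      by move=> _; apply: Rle; [left; exact: R1|lia].
    split; [lia| | |lia].
      move=> _; split => // j jt aj; have [jz|jz] := leqP j (t - z); first by lia.
      by have := gap j; rewrite jz -ltnS jt aj => /(_ isT).
    by move=> _; apply: Rle; [left; exact: R1|lia].
  case: (ltnP z.+1 l) => zl1.
    split; [|lia| |lia].
      move=> _; rewrite subSS; split=> //.
      move=> j jt; have [->|jt'] := eqVneq j t.+1; first by rewrite b.
      by apply: gap; lia.
    move=> _; apply: Rle; last lia.
    move=> _; have [z_0|z_0] := posnP z.
      have [->|[j jt aj]] := short z_0; [by right|left].
      by exists j; rewrite ?aj /=; lia.
    by left; exists (t - z); rewrite ?az /=; lia.
  split; [lia|lia|lia|move=> _].
  exists t.+1 => //; split; first lia.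
  move=> [j jt /and3P[aj jl j1]].
  have [jz|jz] := leqP j (t - z); first lia.
  have [e|jt'] := eqVneq j t.+1; first by rewrite e b in aj.
  by have := gap j; rewrite jz aj => H; have : ~~ true by apply: H; lia.
- have [t0 at_ far] := I2 (esym lz).
  case b: (a t.+1).
    split; [|lia| |lia].
      move=> _; split => //; rewrite ?subn0 //; first by move=> j; lia.
      by move=> _; right; exists t => //; lia.
    by move=> _; apply: Rle; [left; exact: R1|lia].
  split; [lia|lia|lia|move=> _].
  exists t.+1 => //; split; first lia.
  move=> [j jt /and3P[aj jl j1]].
  have [e|jt'] := eqVneq j t.+1; first by rewrite e b in aj.
  have jt2 : j < t by lia.
  by have := far j jt2 aj; lia.
Qed.

(** Above the top one [t] the positions [t + 2], ..., [t + l - 1] are within reach of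
[t].  Only [t + 1] needs an earlier one, and it has it exactly when the state is 0
instead of [l]. *)
Lemma state0_iff l (a : nat -> bool) t : 2 < l -> a 0 -> a t -> (forall j, t < j -> a j = false) ->
  (forall i, i < t + l -> i != 1 -> reached l a i) <-> state l a t = 0.
Proof.
move=> l2 a0 at_ big; have := state_inv t l2 a0.
set z := state l a t => -[I1 I2 I3 I4]; split=> [R|z0].
  case: (ltngtP z l) => [zl|lz|zl].
  - have [zt atz gap _] := I1 zl.
    have [//|zpos] := posnP z.
    have : ~~ a t by apply: gap; lia.
    by rewrite at_.
  - have [i it [i1 nR]] := I4 lz; case: nR; apply: R => //; lia.
  - have [t0 _ far] := I2 zl.
    have [||j jt /and3P[aj jl j1]] := R t.+1; [lia|lia|].
    have [e|jt'] := eqVneq j t.+1; first by rewrite e big in aj.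
    by have := far j _ aj; lia.
move=> i it i1; have [itl|itl] := leqP i t; first by apply: I3 => //; lia.
have [] := I1 _; first lia.
rewrite z0 => _ _ _ /(_ erefl) short.
have [e|it1] := eqVneq i t.+1.
  case: short => [t0|[j jt aj]]; first by rewrite e t0 in i1.
  by exists j; rewrite ?aj /= e; lia.
by exists t; rewrite ?at_ /=; lia.
Qed.

Fixpoint run l z n q := if n is n'.+1 then run l (step l z (odd q)) n' q./2 else z.

Lemma runS l z n q : run l z n.+1 q = step l (run l z n q) (bit q n).
Proof.
elim: n z q => [|n IH] z q; first by rewrite /= bit0.
by rewrite bitS -IH.
Qed.

Lemma state_run l p t : state l (bit p) t = run l 0 t p./2.
Proof. by elim: t => [|t IH] //; rewrite runS -IH -bitS. Qed.

(** The number of words of length [n] that lead from state [z] to state 0. *)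
Fixpoint accepted l z n : nat :=
  if n is n'.+1 then accepted l (step l z true) n' + accepted l (step l z false) n'
  else z == 0.

Lemma sum_double N (F : nat -> nat) :
  \sum_(q < N.*2) F q = \sum_(q < N) (F q.*2.+1 + F q.*2).
Proof.
elim: N => [|N IH]; first by rewrite !big_ord0.
by rewrite doubleS !big_ord_recr /= IH -addnA (addnC (F _)).
Qed.

Lemma accepted_run l z n : \sum_(q < 2 ^ n) (run l z n q == 0) = accepted l z n.
Proof.
elim: n z => [|n IH] z; first by rewrite big_ord1.
rewrite expnS mul2n (sum_double _ (fun q => run l z n.+1 q == 0 : nat)) big_split /=.
congr (_ + _); rewrite -IH; apply: eq_bigr => q _.
  by rewrite odd_double /= uphalf_double.
by rewrite odd_double doubleK.
Qed.

Lemma card_fset_set_nat (D : set nat) N : (forall p, D p -> p < N) ->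
  #|` fset_set D|%fset = \sum_(p < N) `[< D p >].
Proof.
move=> DN; have finD : finite_set D.
  by apply: (@sub_finite_set _ _ `I_N) => //; exact: finite_II.
rewrite -(big_mkord xpredT (fun p => `[< D p >] : nat)) big_mkcond /=.
have -> : #|` fset_set D|%fset = size [seq p <- iota 0 N | `[< D p >]].
  apply/perm_size/uniq_perm; rewrite ?fset_uniq ?filter_uniq ?iota_uniq //.
  move=> p; rewrite mem_filter mem_iota /= add0n.
  rewrite in_fset_set //; apply/idP/andP => [/set_mem Dp|[/asboolP Dp _]]; last exact: mem_set.
  by split; [exact/asboolP | exact: DN].
rewrite size_filter -sum1_count /index_iota subn0 big_mkcond /=.
by apply: eq_bigr => p _; case: (`[< _ >]).
Qed.

Lemma run0_top l z n q : run l z n.+1 q = 0 -> bit q n.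
Proof.
rewrite runS /step; case: (bit q n) => //=.
by case: ifP => // _; case: ifP.
Qed.

(** The divisors of length [m] of [2 ^ (l + m - 1) - 3], so that the cofactor has
length [l]. *)
Definition good l m p := [&& length2 p == m, bit p 0, ~~ bit p 1 & state l (bit p) m.-1 == 0].

Lemma sum_good l m k : 2 < l -> 0 < m <= k ->
  \sum_(p < 2 ^ k) good l m p = if m is m'.+2 then accepted l 1 m' else 1.
Proof.
move=> l2 /andP[m0 mk].
have -> : \sum_(p < 2 ^ k) good l m p = \sum_(p < 2 ^ m) good l m p.
  have H : 2 ^ m <= 2 ^ k by rewrite leq_exp2l.
  rewrite (big_ord_widen _ (fun p => good l m p : nat) H) [in RHS]big_mkcond /=.
  apply: eq_bigr => p _; case: ltnP => // mp.
  rewrite /good; case: eqP => //= lp.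
  by have := length2_lt p; rewrite lp ltnNge mp.
case: m m0 {mk} => [//|m] _.
rewrite expnS mul2n (sum_double _ (fun p => good l m.+1 p : nat)).
have E q : q < 2 ^ m ->
    good l m.+1 q.*2.+1 + good l m.+1 q.*2 = ~~ odd q && (run l 0 m q == 0).
  move=> qm; have -> : good l m.+1 q.*2 = false.
    by rewrite /good bit0 odd_double andbF.
  rewrite addn0 /good bit0 bitS state_run /= odd_double uphalf_double bit0 /=.
  case: eqP => [//|lp]; suff -> : ~~ odd q && (run l 0 m q == 0) = false by [].
  apply/negP => /andP[_ /eqP r0]; apply: lp; apply: length2_eq => //=.
    case: m r0 {qm} => [|m] r0; first by rewrite bit0 /= odd_double.
    rewrite bitS /= uphalf_double; exact: run0_top r0.
  move=> i mi; rewrite /bit divn_small //; apply: leq_trans (_ : 2 ^ m.+1 <= _).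
    by rewrite expnS; lia.
  by rewrite leq_exp2l.
rewrite (eq_bigr (fun q : 'I_(2 ^ m) => ~~ odd q && (run l 0 m q == 0) : nat)); last first.
  by move=> q _; rewrite E.
case: m {E} => [|m]; first by rewrite big_ord1.
rewrite expnS mul2n (sum_double _ (fun q => ~~ odd q && (run l 0 m.+1 q == 0) : nat)).
rewrite -accepted_run; apply: eq_bigr => q _.
rewrite /= odd_double /= doubleK /step.
have -> : l <= 0 = false by lia.
by have -> : 1 < l by lia.
Qed.

(** The two divisors outside the sum are [2 ^ k - 3] and 1.  The others have length
[n + 2] for some [n], hence cofactor length [l = k - 1 - n]; their two lowest digits, a one and
then a zero, lead to state 1. *)
Lemma d2_target k : 2 < k ->
  d2 (2 ^ k - 3) = 2 + \sum_(n < k - 3) accepted (k.-1 - n) 1 n.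
Proof.
move=> k2; rewrite /d2.
have lt_n : 2 ^ k - 3 < 2 ^ k by rewrite ltn_subrL expn_gt0.
have D p : dismal_dvd2 p (2 ^ k - 3) -> p < 2 ^ k.
  move=> /(dismal_dvd2_target p k2)[->//|[l [l2 lp _ _]]].
  by apply: leq_trans (length2_lt p) _; rewrite leq_exp2l //; lia.
rewrite (card_fset_set_nat D).
have E p : `[< dismal_dvd2 p (2 ^ k - 3) >] =
   (p == 2 ^ k - 3) + \sum_(n < k - 2) good (k - n) n.+1 p :> nat.
  have lenP l : 2 < l -> length2 p + l = k.+1 -> bit p 0 && ~~ bit p 1 ->
     (forall i, i < k -> i != 1 -> reached l (bit p) i) <-> state l (bit p) (length2 p).-1 = 0.
    move=> l2 lp /andP[p0 p1].
    have pos : 0 < p by case: (p) p0 => [|n] //; rewrite /bit div0n.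
    rewrite -state0_iff // ?bit_top //; last by move=> j jp; rewrite bit_ge //; lia.
    have -> // : (length2 p).-1 + l = k by rewrite /length2 in lp *; lia.
  have H : `[< dismal_dvd2 p (2 ^ k - 3) >] =
    (p == 2 ^ k - 3) || [&& length2 p <= k - 2 & good (k.+1 - length2 p) (length2 p) p].
    apply/asboolP/orP => [/(dismal_dvd2_target p k2)[->|[l [l2 lp b R]]]|[/eqP->|/andP[lp]]].
    - by left.
    - right; apply/andP; split; first lia.
      have -> : k.+1 - length2 p = l by lia.
      rewrite /good eqxx /=; case/andP: (b) => -> -> /=.
      by apply/eqP/(lenP l l2 lp b).
    - by apply/(dismal_dvd2_target _ k2); left.
    - rewrite /good eqxx /= => /and3P[p0 p1 /eqP s0]; apply/(dismal_dvd2_target _ k2); right.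
      exists (k.+1 - length2 p); have b : bit p 0 && ~~ bit p 1 by rewrite p0 p1.
      have e : length2 p + (k.+1 - length2 p) = k.+1 by lia.
      split => //; first lia.
      by apply/(lenP (k.+1 - length2 p) _ e b) => //; lia.
  rewrite H; have -> : \sum_(n < k - 2) good (k - n) n.+1 p =
     (length2 p <= k - 2) && good (k.+1 - length2 p) (length2 p) p.
    rewrite [LHS](_ : _ = \sum_(n < k - 2 | n == (length2 p).-1 :> nat) good (k - n) n.+1 p); last first.
      rewrite [RHS]big_mkcond /=; apply: eq_bigr => n _; case: eqP => // np.
      case: (length2 p =P n.+1) => [lp|/eqP/negbTE lp]; last by rewrite /good lp.
      by exfalso; move: np lp; rewrite /length2; lia.
    case: (leqP (length2 p) (k - 2)) => lp.
      have lp' : (length2 p).-1 < k - 2 by rewrite /length2 in lp *; lia.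
      by rewrite (big_pred1 (Ordinal lp')) //=.
    rewrite big_pred0 //= => n; apply/negbTE/eqP => np.
    by have := ltn_ord n; rewrite np /length2 in lp *; lia.
  case: eqP => [e|] //=.
  by rewrite e length2_target //; have -> : k <= k - 2 = false by lia.
under eq_bigr do rewrite E.
rewrite big_split /= exchange_big /=.
have -> : \sum_(p < 2 ^ k) (p == 2 ^ k - 3 :> nat) = 1.
  rewrite (bigD1 (Ordinal lt_n)) //= eqxx big1 // => p pn.
  by apply/eqP; rewrite eqb0.
rewrite (eq_bigr (fun n : 'I_(k - 2) => if n : nat is n'.+1 then accepted (k - n) 1 n' else 1)); last first.
  move=> n _; rewrite sum_good //; have := ltn_ord n; lia.
have -> : k - 2 = (k - 3).+1 by lia.
rewrite big_ord_recl /= addnA; congr (_ + _).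
apply: eq_bigr => n _; rewrite /bump /= add1n; congr accepted; lia.
Qed.

End Automaton.

(** * Recurrence for the number of accepted words *)

Section Recurrence.
Local Open Scope nat_scope.

Lemma accepted_dead l z n : l < z -> accepted l z n = 0.
Proof.
elim: n z => [|n IH] z lz; first by case: z lz.
have e b : step l z b = l.+1.
  rewrite /step (ltnW lz).
  have -> : (z == l) = false by apply/eqP; lia.
  by rewrite andbF.
by rewrite /= !e !IH.
Qed.

Section LongWindow.
Variable l : nat.
Hypothesis l2 : 2 < l.
Notation C := (accepted l 0).

(** State [l] accepts only a one, which brings the automaton back to state 0. *)
Lemma accepted_after_long n : accepted l l n = if n is n'.+1 then C n' else 0.
Proof.
case: n => [|n] /=; first by case: (l) l2.
have -> : step l l true = 0 by rewrite /step leqnn eqxx.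
have -> : step l l false = l.+1 by rewrite /step leqnn.
by rewrite (@accepted_dead _ l.+1) ?addn0.
Qed.

Lemma accepted_short z n : z.+2 < l -> accepted l z n.+1 = C n + accepted l z.+1 n.
Proof.
move=> zl /=; rewrite /step.
have -> : l <= z = false by lia.
by have -> : z.+2 < l by []; have -> : z.+1 < l by lia.
Qed.

(** Words of length [n + z] from state 0 are sorted by whether they start with [z]
zeros; otherwise their first one, after [z - 1 - i] zeros, brings them back to state 0
with [n + i] digits to go. *)
Lemma accepted_prefix z n : z.+2 <= l ->
  C (n + z) = accepted l z n + \sum_(i < z) C (n + i).
Proof.
elim: z n => [|z IH] n zl; first by rewrite addn0 big_ord0 addn0.
rewrite addnS -addSn IH; last lia.
rewrite accepted_short // big_ord_recl addn0 addnCA addnA.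
congr (_ + _); apply: eq_bigr => i _; congr (accepted _ _ _); rewrite lift0; lia.
Qed.

(** State [l - 2] is the first from which a one makes a run count as long. *)
Definition longgap j := accepted l l.-2 j.

Lemma longgap0 : longgap 0 = 0.
Proof. by rewrite /longgap /=; case: eqP => // ?; lia. Qed.

Lemma longgapS j : longgap j.+1 = accepted l l j + accepted l l.-1 j.
Proof.
rewrite /longgap /= /step; have -> : l <= l.-2 = false by lia.
have -> : l.-2.+2 < l = false by lia.
have -> : l.-2.+1 < l by lia.
by congr (_ + accepted l _ _); lia.
Qed.

Lemma accepted_last j : accepted l l.-1 j.+1 = accepted l l j.
Proof.
rewrite /= /step; have -> : l <= l.-1 = false by lia.
have -> : l.-1.+2 < l = false by lia.
have -> : l.-1.+1 < l = false by lia.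
by rewrite (@accepted_dead _ l.+1) ?addn0.
Qed.

Lemma longgap1 : longgap 1 = 0.
Proof. by rewrite longgapS accepted_after_long /=; case: eqP => // ?; lia. Qed.

(** After [l - 2] zeros, either two ones follow, or a zero and two ones. *)
Lemma longgapSS j : longgap j.+2 = C j + (if j is j'.+1 then C j' else 0).
Proof. by rewrite longgapS accepted_last !accepted_after_long. Qed.

(** The difference of two consecutive instances of [accepted_prefix] at [z = l - 2]:
the sums of [l - 2] terms cancel but for their ends. *)
Lemma C_rec j : C (j + l.-1) + C j + longgap j = (C (j + l.-2)).*2 + longgap j.+1.
Proof.
have le2 : l.-2.+2 <= l by lia.
have H i := accepted_prefix i le2.
have e : j + l.-1 = j.+1 + l.-2 by lia.
have shift : \sum_(i < l.-2) C (j.+1 + i) + C j = \sum_(i < l.-2) C (j + i) + C (j + l.-2).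
  transitivity (\sum_(i < l.-2.+1) C (j + i)); last by rewrite big_ord_recr.
  rewrite big_ord_recl addn0 addnC; congr (_ + _); apply: eq_bigr => i _.
  by congr (accepted _ _ _); rewrite lift0; lia.
have := H j; have := H j.+1; rewrite -/(longgap j) -/(longgap j.+1).
rewrite e; lia.
Qed.

Lemma C_init n : 0 < n -> n.+2 < l -> C n.+1 = (C n).*2.
Proof.
move=> n0 nl.
have le1 : n.+2 <= l by lia.
have A := accepted_prefix 0 le1; have B := accepted_prefix 0 nl.
rewrite big_ord_recr in B; rewrite !add0n in A B.
have a0 : accepted l n 0 = 0 by case: (n) n0.
rewrite a0 in A; rewrite -addnn {2}A B; exact: addnC.
Qed.

Lemma C1 : C 1 = 1.
Proof. by have := @accepted_prefix 1 0 l2; rewrite big_ord1. Qed.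

End LongWindow.

(** If at most [B] words of length [n] are accepted from any state, then at most
[2 ^ m * B] words of length [m + n] are; when [m] zeros are fatal, one of the
[2 ^ m] prefixes of length [m] is lost. *)
Lemma accepted_block l m B n : (forall z, accepted l z n <= B) ->
  (forall z, accepted l z (m + n) <= 2 ^ m * B) /\
  (forall z, l < z + m -> accepted l z (m + n) <= (2 ^ m).-1 * B).
Proof.
move=> HB; elim: m => [|m [IH1 IH2]].
  split=> z; first by rewrite mul1n; exact: HB.
  by rewrite addn0 => lz; rewrite accepted_dead.
have B0 : 0 < 2 ^ m by rewrite expn_gt0.
split=> z.
  rewrite addSn /=; have := IH1 (step l z true); have := IH1 (step l z false).
  rewrite expnS; lia.
move=> lz; rewrite addSn /=; have := IH1 (step l z true).
have /IH2 : l < step l z false + m.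
  by rewrite /step; case: ifP => ? //=; [lia|case: ifP => ?; lia].
rewrite expnS; nia.
Qed.

Lemma accepted_le l z n : accepted l z n <= 2 ^ n.
Proof.
have [|H _] := @accepted_block l n 1 0; first by move=> z'; case: z'.
by have := H z; rewrite addn0 muln1.
Qed.

(** For [l <= 7] eight zeros are fatal from every state. *)
Lemma accepted_decay l i n z : l < 8 -> accepted l z (i * 8 + n) <= 255 ^ i * 2 ^ n.
Proof.
move=> l8; elim: i z => [|i IH] z; first by rewrite mul1n; exact: accepted_le.
have [_ H] := accepted_block 8 IH.
rewrite mulSn -addnA; apply: leq_trans (H z _) _; first lia.
by rewrite (expnS 255) -mulnA; exact: leqnn.
Qed.

End Recurrence.

(** * Calculus of s e^-s *)

Section Calc.
Variable R : realType.
Implicit Types (f df ddf : R -> R) (a b c s x : R).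

Lemma mean_value f df a b : (forall x, is_derive x 1 f (df x)) -> a <= b ->
  exists2 c, a <= c <= b & f b - f a = df c * (b - a).
Proof.
move=> fdf ab; have [|c] := @MVT_segment R f df a b ab (fun x _ => fdf x).
  apply: derivable_within_continuous => x _; exact: ex_derive.
by rewrite in_itv /= => cab E; exists c.
Qed.

Lemma nneg_of_derive f df : (forall x, is_derive x 1 f (df x)) ->
  f 0 = 0 -> (forall x, 0 <= x -> 0 <= df x) -> forall x, 0 <= x -> 0 <= f x.
Proof.
move=> fdf f0 df0 x x0; have [c /andP[c0 _]] := mean_value fdf x0.
by rewrite f0 !subr0 => ->; rewrite mulr_ge0 // df0.
Qed.

Lemma is_derive_expRN x : is_derive x 1 (fun s : R => expR (- s)) (- expR (- x)).
Proof.
rewrite -mulrN1; apply: (@is_derive1_comp R expR (fun s => - s)).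
Qed.

Lemma is_derive_polyB_expRN (p : {poly R}) (c : R) x :
  is_derive x 1 (fun s => p.[s] + c * expR (- s)) (p^`().[x] - c * expR (- x)).
Proof.
rewrite -mulrN; apply: is_deriveD; apply: is_deriveZ; exact: is_derive_expRN.
Qed.

(** Integrating [1 - x <= exp (- x)] repeatedly gives the Taylor polynomials as
alternating upper and lower bounds. *)
Lemma expRN_taylor s : 0 <= s ->
  [/\ expR (- s) <= 1 - s + s ^+ 2 / 2,
      1 - s + s ^+ 2 / 2 - s ^+ 3 / 6 <= expR (- s) &
      expR (- s) <= 1 - s + s ^+ 2 / 2 - s ^+ 3 / 6 + s ^+ 4 / 24].
Proof.
pose p1 : {poly R} := 1 - 'X.
pose p2 : {poly R} := 1 - 'X + 2^-1 *: 'X^2.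
pose p3 : {poly R} := p2 - 6^-1 *: 'X^3.
pose p4 : {poly R} := p3 + 24^-1 *: 'X^4.
have E0 : expR (- 0 : R) = 1 by rewrite oppr0 expR0.
have step (p q : {poly R}) (e : R) : (forall x, p^`().[x] = - q.[x]) -> p.[0] = 1 ->
    (forall x, 0 <= x -> 0 <= e * (expR (- x) - q.[x])) ->
    forall x, 0 <= x -> 0 <= - e * (expR (- x) - p.[x]).
  move=> pq p0 H x x0.
  have -> : - e * (expR (- x) - p.[x]) = (e *: p).[x] + - e * expR (- x).
    by rewrite hornerZ; ring.
  apply: (nneg_of_derive (is_derive_polyB_expRN (e *: p) (- e)) _ _ x0).
    by rewrite hornerZ p0 E0; ring.
  move=> y /H; rewrite derivZ hornerZ pq; congr (0 <= _); ring.
have H1 x : 0 <= x -> 0 <= 1 * (expR (- x) - p1.[x]).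
  by move=> _; have := expR_ge1Dx (- x); rewrite /p1 !hornerE; lra.
move=> s0.
have D2 : forall x, p2^`().[x] = - p1.[x].
  by move=> x; rewrite /p2 /p1 !poly.derivE !hornerE; lra.
have D3 : forall x, p3^`().[x] = - p2.[x].
  by move=> x; rewrite /p3 /p2 !poly.derivE !hornerE /=; lra.
have D4 : forall x, p4^`().[x] = - p3.[x].
  by move=> x; rewrite /p4 /p3 /p2 !poly.derivE !hornerE /=; lra.
have H2 := step p2 p1 1 D2 _ H1.
have H3 := step p3 p2 _ D3 _ (H2 _).
have H4 := step p4 p3 _ D4 _ (H3 _ _).
have h2 : p2.[0] = 1 by rewrite /p2 !hornerE /=; ring.
have h3 : p3.[0] = 1 by rewrite /p3 /p2 !hornerE /=; ring.
have h4 : p4.[0] = 1 by rewrite /p4 /p3 /p2 !hornerE /=; ring.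
have := H2 h2 s s0; have := H3 h3 h2 s s0; have := H4 h4 h3 h2 s s0.
by rewrite /p4 /p3 /p2 !hornerE /= => A B C; split; lra.
Qed.

(** Convexity as a comparison of the slopes on both sides of [s], cleared of
denominators. *)
Lemma chord_ge f df a b s : (forall x, is_derive x 1 f (df x)) ->
  (forall x y, a <= x -> x <= y -> y <= b -> df x <= df y) ->
  a <= s <= b -> (b - s) * (f s - f a) <= (s - a) * (f b - f s).
Proof.
move=> fdf mono /andP[as_ sb].
have [c /andP[ac cs] ->] := mean_value fdf as_.
have [d /andP[sd db] ->] := mean_value fdf sb.
have dfcd := mono _ _ ac (le_trans cs sd) db.
have -> : (s - a) * (df d * (b - s)) = (b - s) * (df d * (s - a)) by ring.
by rewrite ler_wpM2l ?subr_ge0 // ler_wpM2r ?subr_ge0.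
Qed.

(** Adding or subtracting [f] and the parabola [c / 2 * s ^ 2] gives two
convex functions; for each the chord bound is one half of the claim. *)
Lemma chord_error f df ddf c a b s :
  (forall x, is_derive x 1 f (df x)) -> (forall x, is_derive x 1 df (ddf x)) ->
  (forall x, a <= x <= b -> `|ddf x| <= c) -> a <= s <= b ->
  `|(b - a) * f s - ((b - s) * f a + (s - a) * f b)|
    <= c / 2 * ((s - a) * (b - s) * (b - a)).
Proof.
move=> fdf dfddf ddfc sab.
have key (e : R) : e ^+ 2 = 1 -> 
   e * ((b - a) * f s - ((b - s) * f a + (s - a) * f b))
    <= c / 2 * ((s - a) * (b - s) * (b - a)).
  move=> e2.
  pose p : {poly R} := (c / 2) *: 'X^2.
  have gdg x : is_derive x 1 (fun t => p.[t] + e * f t) (c * x + e * df x).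
    have -> : c * x = p^`().[x] by rewrite /p !poly.derivE !hornerE /=; lra.
    by apply: is_deriveD; apply: is_deriveZ.
  have dgddg x : is_derive x 1 (fun t => c * t + e * df t) (c + e * ddf x).
    have {2}-> : c = c *: 1 by rewrite /GRing.scale /= mulr1.
    by apply: is_deriveD; apply: is_deriveZ.
  have mono x y : a <= x -> x <= y -> y <= b -> c * x + e * df x <= c * y + e * df y.
    move=> ax xy yb; rewrite -subr_ge0.
    have [d /andP[xd dy] ->] := mean_value dgddg xy.
    rewrite mulr_ge0 ?subr_ge0 //.
    have := ddfc d; rewrite (le_trans ax xd) (le_trans dy yb) => /(_ isT).
    have : `|e * ddf d| = `|ddf d|.
      have /eqP := e2; rewrite sqrf_eq1 => /orP[] /eqP ->.
        by rewrite mul1r.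
      by rewrite mulN1r normrN.
    move=> <-; rewrite ler_norml => /andP[]; lra.
  by have := chord_ge gdg mono sab; rewrite /p !hornerE /=; lra.
rewrite ler_norml; apply/andP; split.
  by have := key (-1); rewrite sqrrN expr1n => /(_ erefl); lra.
by have := key 1; rewrite expr1n => /(_ erefl); lra.
Qed.

Definition psi s := s * expR (- s).

Lemma is_derive_psi x : is_derive x 1 psi ((1 - x) * expR (- x)).
Proof.
have -> : (1 - x) * expR (- x) = x *: (- expR (- x)) + expR (- x) *: 1.
  by rewrite /GRing.scale /=; ring.
by apply: is_deriveM; exact: is_derive_expRN.
Qed.

Lemma is_derive2_psi x :
  is_derive x 1 (fun s => (1 - s) * expR (- s)) ((x - 2) * expR (- x)).
Proof.
have -> : (x - 2) * expR (- x) = (1 - x) *: (- expR (- x)) + expR (- x) *: (-1).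
  by rewrite /GRing.scale /=; ring.
apply: is_deriveM; last exact: is_derive_expRN.
rewrite -[-1]add0r; exact: is_deriveD.
Qed.

Lemma psi_chord c a b s : (forall x, a <= x <= b -> `|(x - 2) * expR (- x)| <= c) ->
  a <= s <= b ->
  `|(b - a) * psi s - ((b - s) * psi a + (s - a) * psi b)|
    <= c / 8 * (b - a) ^+ 3.
Proof.
move=> cP sab; have := chord_error is_derive_psi is_derive2_psi cP sab.
move/le_trans; apply.
have c0 : 0 <= c.
  by apply: le_trans (cP s sab); exact: normr_ge0.
case/andP: sab => as_ sb.
have -> : c / 8 * (b - a) ^+ 3 = c / 2 * ((b - a) ^+ 2 / 4 * (b - a)) by field.
rewrite ler_wpM2l ?divr_ge0 // ler_wpM2r ?subr_ge0 ?(le_trans as_) //.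
have := sqr_ge0 ((s - a) - (b - s)); lra.
Qed.
End Calc.

(** * Decay of the density of accepted words *)

Lemma accepted00 l : accepted l 0 0 = 1%N. Proof. by []. Qed.

#[local] Opaque accepted.

(** With [q = 2 ^ - l] the density decreases over one step by [2 * q * loss j], and
[loss j] is about [1 - 1/2 + 1/8 = 5/8] times the density as long as the density
varies slowly. *)
Section Est.
Variable R : realType.
Variable l : nat.
Hypothesis l2 : (2 < l)%N.

Definition density n : R := (accepted l 0 n)%:R / 2 ^+ n.
Let q : R := 2^-1 ^+ l.

Definition loss j : R :=
  ((accepted l 0 j)%:R + (longgap l j)%:R - (longgap l j.+1)%:R) / 2 ^+ j.

Lemma density_step j : density (j + l.-2) - density (j + l.-2).+1 = 2 * q * loss j.
Proof.
have := C_rec l2 j.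
have -> : (j + l.-1 = (j + l.-2).+1)%N by lia.
rewrite -muln2 /density /loss /q.
have -> : 2^-1 ^+ l = (2 ^+ l.-2 * 4)^-1 :> R.
  rewrite exprVn; congr (_^-1); rewrite -{1}(_ : (l.-2 + 2)%N = l); last by lia.
  by rewrite exprD; congr (_ * _); ring.
rewrite !(exprS _ (_ + _)) !exprD.
move: (accepted l 0 (j + l.-2).+1) (accepted l 0 (j + l.-2)) (accepted l 0 j) => b a c.
move: (longgap l j.+1) (longgap l j) => e d.
have Pj : 2 ^+ j != 0 :> R by rewrite expf_neq0.
have Pl : 2 ^+ l.-2 != 0 :> R by rewrite expf_neq0.
move=> /(congr1 (fun n => n%:R : R)); rewrite !natrD natrM => H.
have -> : b%:R = a%:R * 2 + e%:R - c%:R - d%:R :> R by lra.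
by field; rewrite Pj Pl.
Qed.

Lemma loss0 : loss 0 = 1.
Proof. by rewrite /loss longgap0 // longgap1 // accepted00 expr0; lra. Qed.

Lemma loss1 : loss 1 = 0.
Proof. by rewrite /loss longgap1 // longgapSS // C1 // accepted00 addn0; lra. Qed.

Lemma loss2 : loss 2 = density 2 - density 1 / 2.
Proof.
rewrite /loss /density !longgapSS // natrD C1 // accepted00.
by field.
Qed.

Lemma lossSSS j : loss j.+3 = density j.+3 - density j.+2 / 2 + density j / 8.
Proof.
rewrite /loss /density !longgapSS // !natrD !(exprS _ _.+2) !(exprS _ _.+1) !(exprS _ j).
have Pj : 2 ^+ j != 0 :> R by rewrite expf_neq0.
by field; rewrite Pj.
Qed.

Lemma density0 : density 0 = 1. Proof. by rewrite /density accepted00 divr1. Qed.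
Lemma density1 : density 1 = 1 / 2. Proof. by rewrite /density C1 // expr1. Qed.

Lemma density_init n : (0 < n)%N -> (n.+2 < l)%N -> density n.+1 = density n.
Proof.
move=> n0 nl; rewrite /density C_init // -muln2 natrM exprS.
by field; rewrite expf_neq0.
Qed.

Lemma density_ge0 n : 0 <= density n. Proof. by rewrite divr_ge0 // exprn_ge0. Qed.

Lemma density_init_half n : (0 < n)%N -> (n.+1 < l)%N -> density n = 1 / 2.
Proof.
elim: n => [//|[|n] IH] _ nl; first exact: density1.
by rewrite density_init // IH //; lia.
Qed.

Lemma bernoulli (e : R) n : 0 <= e <= 1 -> 1 - n%:R * e <= (1 - e) ^+ n.
Proof.
move=> /andP[e0 e1]; elim: n => [|n IH]; first by rewrite expr0; lra.
rewrite exprS -natr1; have : 0 <= n%:R :> R by [].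
have := ler_wpM2l (_ : 0 <= 1 - e) IH; rewrite subr_ge0 => /(_ e1).
nra.
Qed.

Hypothesis small : 16 * (l.+2)%:R * q <= 1.

Lemma q_gt0 : 0 < q. Proof. by rewrite exprn_gt0 // invr_gt0. Qed.

Let eps := 8 * q.
Let reg N := forall i, (0 < i < N)%N -> (1 - eps) * density i <= density i.+1 <= density i.

Lemma l_bound : 3 <= l%:R :> R. Proof. by rewrite ler_nat. Qed.

Lemma small_mul : 16 * (l%:R + 2) * q <= 1.
Proof. by move: small; rewrite -[l.+2]addn2 natrD. Qed.

Lemma eps_bound : 0 < eps <= 1 / 10.
Proof. rewrite /eps; have := q_gt0; have := small_mul; have := l_bound; nra. Qed.

Lemma chain N i : reg N -> (0 < i <= N)%N ->
  (1 - eps) ^+ (N - i) * density i <= density N <= density i.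
Proof.
move=> regN /andP[i0 iN]; have e := eps_bound.
have [d dE] : exists d, (N = i + d)%N by exists (N - i)%N; lia.
rewrite dE addKn; rewrite {}dE {iN} in regN *; elim: d regN => [|d IH] regN.
  by rewrite addn0 expr0 mul1r lexx.
have /andP[A B] := IH (fun j h => regN j ltac:(lia)).
have /andP[C D] := regN (i + d)%N ltac:(lia).
rewrite addnS (le_trans D B) andbT exprS -mulrA; apply: le_trans C.
by rewrite ler_wpM2l //; lra.
Qed.

Lemma chain_near N i : reg N -> (0 < i <= N)%N -> (N <= i + l.+1)%N ->
  (1 - l.+1%:R * eps) * density i <= density N <= density i.
Proof.
move=> regN iN Ni; have /andP[A ->] := chain regN iN; rewrite andbT.
apply: le_trans A; rewrite ler_wpM2r ?density_ge0 //.
have e := eps_bound.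
apply: le_trans (bernoulli _ _); last by lra.
apply: lerB => //; apply: ler_wpM2r; [lra | by rewrite ler_nat; lia].
Qed.

Lemma leps_half : l.+1%:R * eps <= 1 / 2.
Proof. rewrite -natr1 /eps; have := small_mul; have := q_gt0; nra. Qed.

Lemma near_le2 N i : reg N -> (0 < i <= N)%N -> (N <= i + l.+1)%N -> density i <= 2 * density N.
Proof.
move=> regN iN Ni; have /andP[A _] := chain_near regN iN Ni.
have := leps_half; have := density_ge0 i; nra.
Qed.

(** Induction on the index.  Over a window of [l + 1] steps the density drops by at
most one half by the induction hypothesis, so every density that occurs in [loss j] is
at most twice the current one, and the loss at most four times the current density.
The first indices are treated apart, because the density drops from 1 to 1/2
at the very first step. *)
Lemma regularity N : reg N.
Proof.
elim: N => [|N regN] i; first by case: i.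
have q0 := q_gt0; have ee := eps_bound.
move=> /andP[i0]; rewrite ltnS leq_eqVlt => /predU1P[iN|iN]; last by apply: regN; rewrite i0.
rewrite {i}iN in i0 *.
have uN := density_ge0 N.
have [Nl|Nl] := ltnP N.+2 l; first by rewrite density_init //; nra.
have [j jE] : exists j, (N = j + l.-2)%N by exists (N - l.-2)%N; lia.
have us := density_step j; rewrite -jE in us.
suff [d0 d1] : 0 <= loss j /\ loss j <= 4 * density N.
  by rewrite /eps; apply/andP; split; nra.
have near k : (0 < k)%N -> (j <= k + 3)%N -> (k <= N)%N -> density k <= 2 * density N.
  by move=> k0 jk kN; apply: near_le2 => //; lia.
have step k : (0 < k < N)%N -> (1 - eps) * density k <= density k.+1 <= density k by exact: regN.
case: j jE near us => [|[|[|j]]] jE near _.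
- by rewrite loss0 jE density_init_half //; [lra|lia|lia].
- by rewrite loss1; lra.
- rewrite loss2; have := near 2 ltac:(lia) ltac:(lia) ltac:(lia).
  have := step 1 ltac:(lia); have := density_ge0 1; have := density_ge0 2; nra.
- rewrite lossSSS.
  have n3 := near j.+3 ltac:(lia) ltac:(lia) ltac:(lia).
  have s2 := step j.+2 ltac:(lia).
  have nj : density j <= 4 * density N.
    clear - jE near small l2; have [j0|j0] := posnP j.
      by have := near 1 isT ltac:(lia) ltac:(lia); rewrite j0 density0 density1; lra.
    have := near j j0 ltac:(lia) ltac:(lia); have := density_ge0 N; lra.
  have := density_ge0 j; have := density_ge0 j.+2; nra.
Qed.

Let rho := 5 / 4 * q.

(** Here [rho = 5/4 * q] comes from [2 * q * (1 - 1/2 + 1/8)]; the previous lemma, used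
over one window, shows that the three densities in [loss j] differ from the
current one by a relative error of order [l * q]. *)
Lemma regularity_sharp N : (l + 2 <= N)%N ->
  (1 - rho * (1 + 16 * l.+1%:R * q)) * density N <= density N.+1 <= (1 - rho * (1 - 2 * eps)) * density N.
Proof.
move=> Nl.
have [j jE] : exists j, (N = j.+4 + l.-2)%N by exists (N - l.-2 - 4)%N; lia.
have [h1 h2] : (0 < j.+1 < N.+4)%N /\ (0 < j.+2 < N.+4)%N by lia.
have [h3 h4] : (0 < j.+3 < N.+4)%N /\ (0 < j.+1 <= N)%N by lia.
have [h5 h6] : (N <= j.+1 + l.+1)%N /\ (0 < j.+3 <= N)%N by lia.
have h7 : (N <= j.+3 + l.+1)%N by lia.
have q0 := q_gt0; have ee := eps_bound.
have us := density_step j.+4; rewrite -jE lossSSS in us.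
have /andP[a1 a2] := regularity h3.
have /andP[b1 b2] := chain_near (@regularity N) h4 h5.
have /andP[c1 c2] := chain_near (@regularity N) h6 h7.
have half := leps_half; have uj := density_ge0 j.+1; have uN := density_ge0 N.
set y := l.+1%:R * eps in b1 c1 half.
have -> : 16 * l.+1%:R * q = 2 * y by rewrite /y /eps; ring.
have y0 : 0 <= y by rewrite mulr_ge0 //; lra.
(* For [y <= 1/2] [1 / (1 - y) <= 1 + 2 * y]. *)
have uj_le : density j.+1 <= (1 + 2 * y) * density N by nra.
have u3_le : density j.+3 <= density j.+1.
  have /andP[_ A] := regularity h1.
  by have /andP[_ B] := regularity h2; exact: le_trans B A.
have hi : density j.+4 - density j.+3 / 2 + density j.+1 / 8 <= 5 / 8 * ((1 + 2 * y) * density N) by lra.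
have lo : (5 / 8 - eps) * density N <= density j.+4 - density j.+3 / 2 + density j.+1 / 8.
  have : (1 / 2 - eps) * density N <= (1 / 2 - eps) * density j.+3 by rewrite ler_wpM2l //; lra.
  lra.
have qhi := ler_wpM2l (ltW q0) hi; have qlo := ler_wpM2l (ltW q0) lo.
rewrite /rho; apply/andP; split; first by lra.
have : 0 <= q * (eps * density N) by rewrite !mulr_ge0 //; lra.
lra.
Qed.
End Est.

Section Mid.
Variable R : realType.
Implicit Types x y t : R.

Lemma expR_le_onem t : 0 <= t <= 1 / 4 -> expR (- (t + t ^+ 2)) <= 1 - t.
Proof.
move=> /andP[t0 t4]; have s0 : 0 <= t + t ^+ 2 by nra.
have [A _ _] := expRN_taylor s0; apply: (le_trans A).
have : (1 + t) ^+ 2 <= 2 by nra.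
have := sqr_ge0 t; nra.
Qed.

Lemma expR_ge_cube y : 0 <= y -> y ^+ 2 / 2 <= expR y /\ y ^+ 3 / 6 <= expR y.
Proof.
move=> y0; have := expR_ge1Dxn 1 y0; have := expR_ge1Dxn 2 y0.
rewrite (_ : 2`! = 2)%N // (_ : 3`! = 6)%N // => a b; split; lra.
Qed.

Lemma expR_sub1_le y : 0 <= y -> expR y - 1 <= y * expR y.
Proof.
move=> y0; have := expR_ge1Dx (- y); have := expR_gt0 y.
rewrite expRN => e0 H; have := ler_wpM2r (ltW e0) H.
rewrite mulVf ?gt_eqF //; lra.
Qed.

Lemma pow_small l : (8 <= l)%N -> 16 * l.+2%:R * (2^-1 ^+ l) <= 1 :> R.
Proof.
move=> l8; rewrite exprVn ler_pdivrMr ?exprn_gt0 // mul1r -natrX -natrM ler_nat.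
have [d ->] : exists d, l = (8 + d)%N by exists (l - 8)%N; lia.
by elim: d {l8} => [//|d IH]; rewrite addnS expnS; lia.
Qed.

Lemma density_le_half l n : (2 < l)%N -> 16 * l.+2%:R * (2^-1 ^+ l) <= 1 :> R ->
  (0 < n)%N -> density R l n <= 1 / 2.
Proof.
move=> l2 sm n0; have := @chain R l l2 sm n 1 (@regularity R l l2 sm n).
by rewrite n0 density1 // => /(_ isT) /andP[].
Qed.

(** The density is 1/2 at index 1, loses at most the relative amount [8 * (l + 1) * q]
up to index [l + 2], and from there on decays at the sharp rate. *)
Lemma density_window_ge l d : (2 < l)%N -> 16 * l.+2%:R * (2^-1 ^+ l) <= 1 :> R ->
  1 / 2 * (1 - 8 * l.+1%:R * (2^-1 ^+ l)) *
    (1 - 5 / 4 * (2^-1 ^+ l) * (1 + 16 * l.+1%:R * (2^-1 ^+ l))) ^+ d <= density R l (l + 2 + d).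
Proof.
move=> l2 sm; have q0 := q_gt0 R l.
have b3 := l_bound R l2; have sm' := small_mul sm.
elim: d => [|d IH].
  rewrite expr0 mulr1 addn0.
  have h1 : (0 < 1 <= l + 2)%N by lia.
  have h2 : (l + 2 <= 1 + l.+1)%N by lia.
  have /andP[+ _] := chain_near l2 sm (regularity l2 sm (N := _)) h1 h2.
  rewrite density1 //; lra.
rewrite addnS exprS mulrCA.
have /andP[A _] := regularity_sharp l2 sm (leq_addr d (l + 2)).
apply: le_trans A; rewrite ler_wpM2l //.
rewrite -[l.+1]addn1 natrD; set q := 2^-1 ^+ l in q0 sm' *; nra.
Qed.

Lemma density_window_le l d : (2 < l)%N -> 16 * l.+2%:R * (2^-1 ^+ l) <= 1 :> R ->
  density R l (l + 2 + d) <= 1 / 2 * (1 - 5 / 4 * (2^-1 ^+ l) * (1 - 16 * (2^-1 ^+ l))) ^+ d.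
Proof.
move=> l2 sm; have q0 := q_gt0 R l.
have b3 := l_bound R l2; have sm' := small_mul sm.
elim: d => [|d IH].
  by rewrite expr0 mulr1 addn0 density_le_half // addn2.
rewrite addnS exprS mulrCA.
have /andP[_ A] := regularity_sharp l2 sm (leq_addr d (l + 2)).
apply: (le_trans A).
have -> : 2 * (8 * 2^-1 ^+ l) = 16 * 2^-1 ^+ l :> R by ring.
rewrite ler_wpM2l //.
set q := 2^-1 ^+ l in q0 sm' *; nra.
Qed.

(** Twice the proportion of words of length [n] accepted from state 1; since the density
starts at 1/2, this is the factor that tends to [exp (- x)]. *)
Definition survival l n : R := 4 * density R l n.+1 - 2 * density R l n.

Lemma survivalE l k n : (2 < l)%N -> (n + l.+1 = k)%N ->
  5 * k%:R * (accepted l 1 n)%:R / 2 ^+ k = 5 * k%:R / 2 ^+ l.+2 * survival l n.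
Proof.
move=> l2 <-; rewrite /survival /density.
rewrite accepted_short // natrD !exprD !(exprS _ l.+1) !(exprS _ l) !(exprS _ n).
have Pj : 2 ^+ n != 0 :> R by rewrite expf_neq0.
have Pl : 2 ^+ l != 0 :> R by rewrite expf_neq0.
by field; rewrite Pj Pl.
Qed.

Lemma survival_bounds l n : (2 < l)%N -> 16 * l.+2%:R * (2^-1 ^+ l) <= 1 :> R -> (0 < n)%N ->
  2 * (1 - 16 * 2^-1 ^+ l) * density R l n <= survival l n <= 2 * density R l n.
Proof.
move=> l2 sm n0.
have h : (0 < n < n.+1)%N by rewrite n0 leqnn.
have /andP[A B] := regularity l2 sm h.
by rewrite /survival; apply/andP; split; lra.
Qed.
End Mid.

Section Mid2.
Variable R : realType.
Implicit Types x y t : R.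

(** In this lemma and the next, [L] and [q] stand for [l] and [2 ^ - l], and
[x = 5 * k / 2 ^ (l + 2)].  A power with base [1 - x / k], up to a relative error [O(L * q)] in [x / k],
and an exponent within [O(L)] of [k] is [exp (- x)] up to an error of order
[L * q * (1 + x)] times [exp (- x)] from below and [exp (- x / 2)] from above. *)
Lemma power_ge (L q : R) (d k : nat) (x := k%:R * (5 / 4 * q)) :
  3 <= L -> 0 < q -> 16 * (L + 2) * q <= 1 -> (d <= k)%N ->
  expR (- x) * (1 - 21 * (L + 3) * q * (1 + x)) <=
  (1 - 16 * q) * (1 - 8 * (L + 1) * q) * (1 - 5 / 4 * q * (1 + 16 * (L + 1) * q)) ^+ d.
Proof.
move=> L3 q0 sm dk; set t := 5 / 4 * q * (1 + 16 * (L + 1) * q).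
have Lq : 0 <= L * q by rewrite mulr_ge0 //; lra.
have w1 : 16 * (L + 1) * q <= 1 by lra.
have t0 : 0 <= t by rewrite /t !mulr_ge0 //; lra.
have t1 : t <= 5 / 2 * q by rewrite /t; nra.
have t4 : 0 <= t <= 1 / 4 by apply/andP; split => //; nra.
have pw : expR (- (k%:R * (t + t ^+ 2))) <= (1 - t) ^+ d.
  apply: le_trans (_ : (1 - t) ^+ k <= _); last by rewrite ler_wiXn2l //; lra.
  rewrite -mulrN expRM_natl lerXn2r ?nnegrE ?expR_ge0 ?expR_le_onem //; lra.
set K : R := k%:R in x pw *; have K0 : 0 <= K by rewrite ler0n.
have x0 : 0 <= x by rewrite !mulr_ge0 //; lra.
pose c := x * (16 * (L + 1) * q + 5 * q).
have pw2 : expR (- x) * (1 - c) <= expR (- (K * (t + t ^+ 2))).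
  have le1 : K * (t + t ^+ 2) <= x + c.
    have : t + t ^+ 2 <= 5 / 4 * q * (1 + (16 * (L + 1) * q + 5 * q)).
      have : t ^+ 2 <= (5 / 2 * q) ^+ 2 by rewrite lerXn2r ?nnegrE //; lra.
      by rewrite {2}/t; lra.
    move=> /(ler_wpM2l K0); rewrite /c /x; lra.
  apply: le_trans (_ : expR (- (x + c)) <= _); last by rewrite ler_expR lerN2.
  by rewrite opprD expRD ler_wpM2l ?expR_ge0 // expR_ge1Dx.
have e0 := expR_gt0 (- x).
have c0 : 0 <= c by rewrite mulr_ge0 //; lra.
have a01 : 0 <= 1 - 16 * q by lra.
have b01 : 0 <= 1 - 8 * (L + 1) * q by lra.
apply: le_trans (_ : (1 - 16 * q) * (1 - 8 * (L + 1) * q) * (expR (- x) * (1 - c)) <= _); last first.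
  by rewrite ler_wpM2l ?(le_trans pw2) // mulr_ge0.
rewrite [leRHS]mulrCA ler_wpM2l ?(ltW e0) //.
have -> : 1 - 21 * (L + 3) * q * (1 + x) = 1 - 16 * q - 8 * (L + 1) * q - c
   - (21 * (L + 3) - 16 - 8 * (L + 1)) * q - x * q * (21 * (L + 3) - (16 * (L + 1) + 5)).
  by rewrite /c; ring.
have p1 : 0 <= (21 * (L + 3) - 16 - 8 * (L + 1)) * q by rewrite mulr_ge0 //; lra.
have p2 : 0 <= x * q * (21 * (L + 3) - (16 * (L + 1) + 5)) by rewrite !mulr_ge0 //; lra.
have a0 : 0 <= 16 * q by lra.
have b0 : 0 <= 8 * (L + 1) * q by lra.
move: a0 b0 a01 b01 c0 p1 p2; clear.
set a := 16 * q; set b := 8 * (L + 1) * q => a0 b0 a1 b1 c0 e0 f0.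
have ab : 0 <= a * b by rewrite mulr_ge0.
have p : (1 - a) * (1 - b) <= 1 by apply: mulr_ile1; lra.
have := ler_piMl c0 p.
lra.
Qed.

Lemma power_le (L q : R) (d l k : nat) (x := k%:R * (5 / 4 * q)) : L = l%:R ->
  3 <= L -> 0 < q -> 16 * (L + 2) * q <= 1 -> (d + (2 * l + 3) = k)%N ->
  (1 - 5 / 4 * q * (1 - 16 * q)) ^+ d <= expR (- x) + 21 * (L + 3) * q * (1 + x) * expR (- (x / 2)).
Proof.
move=> LE L3 q0 sm dk.
have Lq : 0 <= L * q by rewrite mulr_ge0 //; lra.
set t := 5 / 4 * q * (1 - 16 * q).
have t0 : 0 <= t by rewrite /t !mulr_ge0 //; lra.
have t1 : t <= 5 / 4 * q by rewrite /t ler_piMr //; lra.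
have pw : (1 - t) ^+ d <= expR (- (d%:R * t)).
  rewrite -(mulrN d%:R t) expRM_natl lerXn2r ?nnegrE ?expR_ge0 ?expR_ge1Dx //; lra.
apply: (le_trans pw).
have dE : d%:R = k%:R - (2 * L + 3) :> R by rewrite -dk LE natrD natrD natrM; lra.
set K : R := k%:R in x dE *; have K0 : 0 <= K by rewrite ler0n.
have x0 : 0 <= x by rewrite !mulr_ge0 //; lra.
pose y := 16 * q * x + 5 / 4 * (2 * L + 3) * q.
have qx : 0 <= q * x by rewrite mulr_ge0 // ltW.
have y0 : 0 <= y by rewrite /y; lra.
have le1 : x - y <= d%:R * t.
  rewrite dE mulrBl /y; have -> : K * t = x - 16 * q * x by rewrite /t /x; ring.
  have : (2 * L + 3) * t <= (2 * L + 3) * (5 / 4 * q) by rewrite ler_wpM2l //; lra.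
  lra.
apply: le_trans (_ : expR (- (x - y)) <= _); first by rewrite ler_expR lerN2.
rewrite opprB addrC expRD -lerBlDl -{2}[expR (- x)]mulr1 -mulrBr.
have y_le : y <= x / 2 + 1.
  have : 16 * q * x <= 1 / 2 * x by rewrite ler_wpM2r //; lra.
  by rewrite /y; lra.
(* Half of the decay [exp (- x)] is spent on [exp y], where [y <= x / 2 + 1]. *)
have ey : expR y <= 3 * expR (x / 2).
  apply: le_trans (_ : expR (x / 2 + 1) <= _); first by rewrite ler_expR.
  rewrite expRD mulrC ler_wpM2r ?expR_ge0 //.
  have h : 0 <= 1 :> R by [].
  have [_ A _] := expRN_taylor h; rewrite expRN in A.
  have e1 := expR_gt0 (1 : R); have := ler_wpM2r (ltW e1) A.
  rewrite mulVf ?gt_eqF //; lra.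
have := expR_sub1_le y0 => s1.
have e0 := expR_gt0 (- x).
apply: le_trans (ler_wpM2l (ltW e0) s1) _.
apply: le_trans (_ : expR (- x) * (y * (3 * expR (x / 2))) <= _).
  by rewrite !ler_wpM2l // ltW.
have -> : expR (- x) * (y * (3 * expR (x / 2))) = 3 * y * expR (- (x / 2)).
  have -> : - x = - (x / 2) - x / 2 by field.
  by rewrite expRD (expRN (x / 2)); field; rewrite gt_eqF ?expR_gt0.
rewrite ler_wpM2r ?expR_ge0 // /y.
have : 0 <= L * (q * x) by rewrite mulr_ge0 //; lra.
lra.
Qed.

Lemma survival_error l n k (x : R := 5 * k%:R / 2 ^+ l.+2) : (8 <= l)%N ->
  (n + l.+1 = k)%N -> (l + 2 <= n)%N ->
  `|survival R l n - expR (- x)| <= 21 * (l%:R + 3) * 2^-1 ^+ l * (1 + x) * expR (- (x / 2)).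
Proof.
move=> l8 nk ln; have l2 : (2 < l)%N by lia.
have n0 : (0 < n)%N by lia.
have [d nE] : exists d, (n = l + 2 + d)%N by exists (n - (l + 2))%N; lia.
have dk : (d <= k)%N by lia.
have dk2 : (d + (2 * l + 3) = k)%N by lia.
have sm := @pow_small R l l8; have q0 := q_gt0 R l.
have b3 := l_bound R l2; have sm' := small_mul sm.
have /andP[A B] := survival_bounds l2 sm n0.
have xE : x = k%:R * (5 / 4 * 2^-1 ^+ l).
  by rewrite /x exprVn !exprS; field; rewrite expf_neq0.
have H1 := power_ge b3 q0 sm' dk; have H2 := power_le erefl b3 q0 sm' dk2.
have U1 := density_window_ge d l2 sm; have U2 := density_window_le d l2 sm.
rewrite -nE -[l.+1]addn1 natrD in U1; rewrite -nE in U2.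
rewrite -!xE in H1 H2.
have x0 : 0 <= x by rewrite divr_ge0 ?exprn_ge0 ?mulr_ge0.
have exh : expR (- x) <= expR (- (x / 2)) by rewrite ler_expR; lra.
move: exh H1 H2 U1 U2 A B q0 sm' b3 x0 {xE sm}.
move: (2^-1 ^+ l) (l%:R : R) (expR (- x)) (expR (- (x / 2))) (survival R l n) (density R l n).
move=> q L e1 e2 s un e12 H1 H2 U1 U2 A B q0 sm b3 x0.
move: H2 U2; set P := (_ ^+ d) => H2 U2.
rewrite ler_norml; apply/andP; split; last by lra.
have Lq : 0 <= L * q by rewrite mulr_ge0 //; lra.
have a0 : 0 <= 1 - 16 * q by lra.
have := ler_wpM2l a0 U1.
have : 21 * (L + 3) * q * (1 + x) * e1 <= 21 * (L + 3) * q * (1 + x) * e2.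
  by rewrite ler_wpM2l // !mulr_ge0 //; lra.
move: H1; set P' := (_ ^+ d) => H1; lra.
Qed.

(** The error of the survival factor is [2 ^ - l = 4 * x / (5 * k)] times a function of
[x] that stays bounded after multiplication by [x], since
[x ^ 2 * (1 + x) * exp (- x / 2) <= 56]. *)
Lemma term_error l n k (x : R := 5 * k%:R / 2 ^+ l.+2) : (8 <= l)%N ->
  (n + l.+1 = k)%N -> (l + 2 <= n)%N ->
  `|5 * k%:R * (accepted l 1 n)%:R / 2 ^+ k - psi x| <= 1000 * (l%:R + 3) / k%:R.
Proof.
move=> l8 nk ln; have l2 : (2 < l)%N by lia.
have k0 : 0 < k%:R :> R by rewrite ltr0n; lia.
rewrite (survivalE R l2 nk) -/x /psi -mulrBr normrM.
have x0 : 0 <= x by rewrite divr_ge0 ?exprn_ge0 ?mulr_ge0.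
rewrite (ger0_norm x0).
apply: le_trans (ler_wpM2l x0 (survival_error l8 nk ln)) _.
rewrite -/x; have -> : 2^-1 ^+ l = 4 * x / (5 * k%:R).
  by rewrite /x exprVn !exprS; field; rewrite gt_eqF ?expf_neq0.
have y0 : 0 <= x / 2 by rewrite divr_ge0.
have [s2 s3] := expR_ge_cube y0.
have e0 := expR_gt0 (x / 2).
have K : x ^+ 2 * (1 + x) * expR (- (x / 2)) <= 56.
  by rewrite expRN ler_pdivrMr //; lra.
have -> : x * (21 * (l%:R + 3) * (4 * x / (5 * k%:R)) * (1 + x) * expR (- (x / 2)))
  = 84 / 5 * (l%:R + 3) * (x ^+ 2 * (1 + x) * expR (- (x / 2))) / k%:R.
  by field; rewrite gt_eqF.
rewrite ler_pM2r ?invr_gt0 //.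
have L0 : 0 <= 84 / 5 * (l%:R + 3) :> R by rewrite mulr_ge0 ?addr_ge0.
apply: le_trans (ler_wpM2l L0 K) _.
have : 0 <= l%:R :> R by []. lra.
Qed.
End Mid2.

(** * Fixed-point evaluation *)

Section FixedPoint.
Local Open Scope Z_scope.

(** Numbers in [[0, 1]] are represented by integers at scale [2 ^ 50].  For [a]
representing [y], these are a lower and an upper bound for the sum of
[2 ^ i * y ^ (2 ^ i)] over [i <= k], by repeated squaring with each square rounded
down or up. *)
Fixpoint doubling_lo (k : nat) (a : Z) : Z :=
  if k is S k' then a + 2 * doubling_lo k' (Z.shiftr (a * a) 50) else a.
Fixpoint doubling_hi (k : nat) (a : Z) : Z :=
  if k is S k' then a + 2 * doubling_hi k' (Z.shiftr (a * a) 50 + 1) else a.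
Lemma doubling_loS k a : doubling_lo (S k) a = a + 2 * doubling_lo k (Z.shiftr (a * a) 50).
Proof. by []. Qed.
Lemma doubling_hiS k a : doubling_hi (S k) a = a + 2 * doubling_hi k (Z.shiftr (a * a) 50 + 1).
Proof. by []. Qed.

(** The cubic Taylor polynomial of [exp (- n / P)], rounded down to scale [2 ^ 50]. *)
Definition expN_lo (P n : Z) : Z :=
  ((((3 * P - n) * n - 6 * P * P) * n + 6 * P * P * P) * 2 ^ 50)
   / (6 * P * P * P).

Fixpoint sqr_iter_lo (k : nat) (a : Z) : Z :=
  if k is S k' then sqr_iter_lo k' (Z.shiftr (a * a) 50) else a.
Fixpoint sqr_iter_hi (k : nat) (a : Z) : Z :=
  if k is S k' then sqr_iter_hi k' (Z.shiftr (a * a) 50 + 1) else a.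

(** The constants are [2 ^ 25 = 33554432], [2 ^ 50 = 1125899906842624] and the unit
[1e-9] of [lo] and [hi].  With [s = n / 2 ^ 25], what is enclosed is
[s * (D + 1)], where [D] is the sum approximated by [doubling_lo] at [y = exp (- s)] and
[s * D] is the sum of [psi (s * 2 ^ i)] over [i < 20]; the 2 in [a + 2] absorbs the
errors of [expN_lo]. *)
Definition grid_test (lo hi n : Z) : bool :=
  let a := expN_lo 33554432 n in
  Z.leb (lo * (1125899906842624 * 33554432))
    (1000000000 * (n * (doubling_lo 19 a + 1125899906842624))) &&
  Z.leb (1000000000 * (n * (doubling_hi 19 (a + 2) + 1125899906842624)))
    (hi * (1125899906842624 * 33554432)).
Fixpoint grid_test_from (lo hi : Z) (c : nat) (n : Z) : bool :=
  if c is S c' then grid_test lo hi n && grid_test_from lo hi c' (n + 1) else true.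

(** The sum over all dyadic scales may deviate from [1 / ln 2 = 1.442695041] by
[1442695041e-14 = 14427e-9]; the two limits below leave about [165e-9] on each side for
interpolation and tails. *)
Lemma grid_test_all : grid_test_from 1442680782 1442709306 2049 2048 = true.
Proof. by vm_cast_no_check (@erefl bool true). Qed.
Lemma grid_test_5_4 : grid_test 1442681212 1442681213 2560 = true.
Proof. by vm_compute. Qed.
Lemma grid_test_15_8 : grid_test 1442708719 1442708720 3840 = true.
Proof. by vm_compute. Qed.

(** Here [8796093022208 = 2 ^ 43], and thirteen squarings turn [exp (- n / 2 ^ 43)] into
[exp (- n / 2 ^ 30)], to be compared with [1/2 = exp (- ln 2)]. *)
Lemma ln2_test : Z.leb (2 ^ 49) (sqr_iter_lo 13 (expN_lo 8796093022208 744261117)) &&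
  Z.leb (sqr_iter_hi 13 (expN_lo 8796093022208 744261118 + 2)) (2 ^ 49).
Proof. by vm_compute. Qed.

End FixedPoint.

Delimit Scope Z_scope with ZZ.

Section Fixpt.
Variable R : realType.
Definition Z2R (z : Z) : R := (int_of_Z z)%:~R.
Lemma Z2R_D a b : Z2R (a + b)%ZZ = Z2R a + Z2R b.
Proof. by rewrite /Z2R -intrD; congr (_%:~R); lia. Qed.
Lemma Z2R_B a b : Z2R (a - b)%ZZ = Z2R a - Z2R b.
Proof. by rewrite /Z2R -intrB; congr (_%:~R); lia. Qed.
Lemma Z2R_M a b : Z2R (a * b)%ZZ = Z2R a * Z2R b.
Proof. by rewrite /Z2R -intrM; congr (_%:~R); lia. Qed.
Lemma Z2R_le a b : (a <= b)%ZZ -> Z2R a <= Z2R b.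
Proof. by move=> ab; rewrite /Z2R ler_int; lia. Qed.
Lemma Z2R_nat n : Z2R (Z.of_nat n) = n%:R.
Proof. by rewrite pmulrn /Z2R; congr (_%:~R); lia. Qed.

Lemma Z2R_lt a b : (a < b)%ZZ -> Z2R a < Z2R b.
Proof. by move=> ab; rewrite /Z2R ltr_int; lia. Qed.
Lemma Z2R_pow a n : Z2R (a ^ Z.of_nat n)%ZZ = Z2R a ^+ n.
Proof.
elim: n => [|n IH]; first by rewrite expr0.
by rewrite Nat2Z.inj_succ Z.pow_succ_r ?Z2R_M ?IH ?exprS //; lia.
Qed.

Lemma Z2R_div a b : (0 < b)%ZZ ->
  Z2R (a / b) * Z2R b <= Z2R a /\ Z2R a <= (Z2R (a / b) + 1) * Z2R b.
Proof.
move=> b0; have [A B] := Z.mod_pos_bound a b b0; have E := Z.div_mod a b.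
rewrite -[1]/(Z2R 1) -Z2R_D -!Z2R_M; split; apply: Z2R_le; nia.
Qed.

Variables (S : R) (SE : S = 2 ^+ 50).

Lemma Z2R_shiftr a :
  Z2R (Z.shiftr a 50) * S <= Z2R a /\ Z2R a <= (Z2R (Z.shiftr a 50) + 1) * S.
Proof.
by rewrite Z.shiftr_div_pow2 // SE -(Z2R_pow 2 50); apply: Z2R_div.
Qed.

Lemma shiftr_sqr_le a (y : R) : (0 <= a)%ZZ -> Z2R a <= y * S ->
  Z2R (Z.shiftr (a * a) 50) <= y ^+ 2 * S.
Proof.
move=> a0 ay; have [H _] := Z2R_shiftr (a * a)%ZZ.
have S0 : 0 < S by rewrite SE exprn_gt0.
rewrite -(ler_pM2r S0); apply: (le_trans H).
have -> : y ^+ 2 * S * S = (y * S) * (y * S) by ring.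
by rewrite Z2R_M; apply: ler_pM => //; exact: (Z2R_le a0).
Qed.

Lemma shiftr_sqr_ge a (y : R) : 0 <= y -> y * S <= Z2R a ->
  y ^+ 2 * S <= Z2R (Z.shiftr (a * a) 50 + 1)%ZZ.
Proof.
move=> y0 ay; have [_ H] := Z2R_shiftr (a * a)%ZZ.
have S0 : 0 < S by rewrite SE exprn_gt0.
rewrite -(ler_pM2r S0) Z2R_D; apply: le_trans H.
have -> : y ^+ 2 * S * S = (y * S) * (y * S) by ring.
by rewrite Z2R_M; apply: ler_pM => //; rewrite mulr_ge0 // ltW.
Qed.

Fixpoint doubling_sum (k : nat) (y : R) : R :=
  if k is k'.+1 then y + 2 * doubling_sum k' (y ^+ 2) else y.

Lemma doubling_lo_le k a y : (0 <= a)%ZZ -> Z2R a <= y * S -> Z2R (doubling_lo k a) <= doubling_sum k y * S.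
Proof.
elim: k a y => [//|k IH] a y a0 ay; rewrite doubling_loS -[doubling_sum _ _]/(y + 2 * doubling_sum k (y ^+ 2)).
have -> : (y + 2 * doubling_sum k (y ^+ 2)) * S = y * S + 2 * (doubling_sum k (y ^+ 2) * S).
  ring.
rewrite Z2R_D Z2R_M lerD // ler_wpM2l //; apply: IH.
  by rewrite Z.shiftr_nonneg; nia.
exact: shiftr_sqr_le.
Qed.

Lemma doubling_hi_ge k a y : 0 <= y -> y * S <= Z2R a -> doubling_sum k y * S <= Z2R (doubling_hi k a).
Proof.
elim: k a y => [//|k IH] a y y0 ay; rewrite doubling_hiS -[doubling_sum _ _]/(y + 2 * doubling_sum k (y ^+ 2)).
have -> : (y + 2 * doubling_sum k (y ^+ 2)) * S = y * S + 2 * (doubling_sum k (y ^+ 2) * S).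
  ring.
rewrite Z2R_D Z2R_M lerD // ler_wpM2l //; apply: IH.
  exact: exprn_ge0.
exact: shiftr_sqr_ge.
Qed.

Lemma sqr_iter_lo_le k a y : (0 <= a)%ZZ -> Z2R a <= y * S ->
  Z2R (sqr_iter_lo k a) <= y ^+ (2 ^ k) * S.
Proof.
elim: k a y => [|k IH] a y a0 ay /=; first by rewrite expr1.
rewrite expnS exprM; apply: IH; last exact: shiftr_sqr_le.
by rewrite Z.shiftr_nonneg; nia.
Qed.

Lemma sqr_iter_hi_ge k a y : 0 <= y -> y * S <= Z2R a ->
  y ^+ (2 ^ k) * S <= Z2R (sqr_iter_hi k a).
Proof.
elim: k a y => [|k IH] a y y0 ay; first by rewrite expn0 expr1; exact: ay.
rewrite -[sqr_iter_hi _ _]/(sqr_iter_hi k (Z.shiftr (a * a) 50 + 1)%ZZ).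
rewrite expnS exprM; apply: IH; last exact: shiftr_sqr_ge.
exact: exprn_ge0.
Qed.

(** For [s = n / P <= 2 ^ -13] the next Taylor term [s ^ 4 / 24] is below one unit of
scale [2 ^ -50], and rounding costs at most another one. *)
Lemma expN_lo_bounds (P n : Z) : (0 <= n)%ZZ -> (2 ^ 13 * n <= P)%ZZ -> (0 < P)%ZZ ->
  [/\ (0 <= expN_lo P n)%ZZ, Z2R (expN_lo P n) <= expR (- (Z2R n / Z2R P)) * S
    & expR (- (Z2R n / Z2R P)) * S <= Z2R (expN_lo P n + 2)%ZZ].
Proof.
move=> n0 nP P0.
have zP0 : 0 < Z2R P.
  have : (1 <= P)%ZZ by lia.
  by move=> /Z2R_le; apply: lt_le_trans; exact: ltr01.
have zn0 : 0 <= Z2R n by exact: (Z2R_le n0).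
have D0 : (0 < 6 * P * P * P)%ZZ by nia.
have np : (n <= P)%ZZ by nia.
pose s : R := Z2R n / Z2R P.
have s0 : 0 <= s by rewrite divr_ge0 // ltW.
have sle : s <= (2 ^+ 13)^-1.
  rewrite ler_pdivrMr // ler_pdivlMl ?exprn_gt0 //.
  by have := Z2R_le nP; rewrite Z2R_M (Z2R_pow 2 13).
have [_ T1 T2] := expRN_taylor s0.
rewrite -/s; set y := expR (- s) in T1 T2 *.
have Es : Z2R n = s * Z2R P by rewrite /s divfK // gt_eqF.
rewrite Z2R_D -[Z2R 2]/(2 : R).
have S0 : 0 < S by rewrite SE exprn_gt0.
have s4 : s ^+ 4 / 24 * S <= 1.
  have h : s ^+ 4 <= ((2 ^+ 13)^-1) ^+ 4 by rewrite lerXn2r ?nnegrE // invr_ge0 exprn_ge0.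
  apply: le_trans (_ : ((2 ^+ 13)^-1) ^+ 4 / 24 * S <= _).
    by rewrite ler_pM2r // ler_pM2r // invr_gt0.
  by rewrite SE; lra.
rewrite /expN_lo.
have : Z2R (2 ^ 50)%ZZ = S by rewrite SE (Z2R_pow 2 50).
have : (0 < 2 ^ 50)%ZZ by [].
move: (2 ^ 50)%ZZ => Q Q0 EQ.
set N := (((((3 * P - n) * n - 6 * P * P) * n + 6 * P * P * P) * Q))%ZZ.
have [A B] := Z2R_div N D0.
have EN : Z2R N = (1 - s + s ^+ 2 / 2 - s ^+ 3 / 6) * Z2R (6 * P * P * P)%ZZ * S.
  rewrite /N !(Z2R_M, Z2R_D, Z2R_B) EQ Es -[Z2R 6]/(6 : R) -[Z2R 3]/(3 : R).
  by rewrite /=; lra.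
have D1 : 0 < Z2R (6 * P * P * P)%ZZ by rewrite !Z2R_M !mulr_gt0.
rewrite EN mulrAC in A B.
rewrite -[X in X <= _]mulrAC in B.
split.
- apply: Z.div_pos => //; clear -n0 np P0 Q0.
  have -> : N = (((3 * P - n) * (n * n) + 6 * (P * P) * (P - n)) * Q)%ZZ by rewrite /N; lia.
  by apply: Z.mul_nonneg_nonneg; [apply: Z.add_nonneg_nonneg; apply: Z.mul_nonneg_nonneg|]; nia.
- move: A; rewrite ler_pM2r // => /le_trans; apply; exact: ler_wpM2r (ltW S0) _ _ T1.
- have {}B : (1 - s + s ^+ 2 / 2 - s ^+ 3 / 6) * S <= Z2R (N / (6 * P * P * P))%ZZ + 1.
    by rewrite -(ler_pM2r D1) mulrAC.
  have := ler_wpM2r (ltW S0) T2; lra.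
Qed.
End Fixpt.

Section Grid.
Variable R : realType.
Local Notation Z2R := (@Z2R R).

(** Since [exp (- s) ^ (2 ^ i) = exp (- s * 2 ^ i)], one exponential and a few
squarings give all the terms. *)
Lemma doubling_sum_psi k (s : R) :
  s * doubling_sum k (expR (- s)) = \sum_(i < k.+1) psi (s * 2 ^+ i).
Proof.
elim: k s => [|k IH] s; first by rewrite big_ord1 mulr1.
rewrite big_ord_recl expr0 mulr1 -[doubling_sum _ _]/(expR (- s) + 2 * doubling_sum k (expR (- s) ^+ 2)).
have -> : expR (- s) ^+ 2 = expR (- (2 * s)).
  by rewrite -expRM_natl; congr expR; ring.
rewrite mulrDr mulrCA mulrA IH; congr (_ + _); apply: eq_bigr => i _.
by congr psi; rewrite /= /bump /= add1n exprS; ring.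
Qed.

(** The scales [2 ^ -14], ..., [2 ^ 5] of the dyadic sum at [x]; the last summand
[x / 2 ^ 14] stands for all the lower scales, where [psi s] is nearly [s]. *)
Definition core (x : R) := \sum_(i < 20) psi (x / 2 ^+ 14 * 2 ^+ i) + x / 2 ^+ 14.

Lemma grid_test_fromP lo hi c n i : grid_test_from lo hi c n -> (i < c)%N ->
  grid_test lo hi (n + Z.of_nat i)%ZZ.
Proof.
elim: c n i => [//|c IH] n [|i] /= /andP[tn tc] ic.
  by rewrite Z.add_0_r.
by have := IH _ i tc ic; congr grid_test; lia.
Qed.

Lemma grid_test_core lo hi n : (2048 <= n <= 4096)%N -> grid_test lo hi (Z.of_nat n) ->
  Z2R lo <= 10 ^+ 9 * core (n%:R / 2 ^+ 11) <= Z2R hi.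
Proof.
move=> n1; rewrite /grid_test.
have E25 : Z2R 33554432 = 2 ^+ 25 by rewrite -(Z2R_pow _ 2 25).
have E50 : Z2R 1125899906842624 = 2 ^+ 50 by rewrite -(Z2R_pow _ 2 50).
have E9 : Z2R 1000000000 = 10 ^+ 9.
  have -> : (1000000000 = (10 * 10 * 10) * (10 * 10 * 10) * (10 * 10 * 10))%ZZ by [].
  by rewrite !Z2R_M -[Z2R 10]/(10 : R); ring.
have p1 : (0 <= Z.of_nat n)%ZZ by lia.
have p2 : (2 ^ 13 * Z.of_nat n <= 33554432)%ZZ by lia.
have [S [SE]] : exists S : R, S = 2 ^+ 50 /\ 0 < S.
  exists (2 ^+ 50); split; first exact: erefl.
  by rewrite exprn_gt0 // ltr0n.
rewrite -SE in E50.
move=> S0; have [a0 A B] := expN_lo_bounds SE p1 p2 erefl.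
have A' := doubling_lo_le SE 19 a0 A; have B' := doubling_hi_ge SE 19 (expR_ge0 _) B.
move: A' B' E25 E50 E9 {A B a0 p2}.
move: 33554432%ZZ 1125899906842624%ZZ 1000000000%ZZ => P25 P50 P9.
move: (doubling_lo 19 _) (doubling_hi 19 _) => ql1 qu1 A' B' E25 E50 E9.
move=> /andP[/Z.leb_le /(@Z2R_le R) + /Z.leb_le /(@Z2R_le R)].
rewrite !(Z2R_M, Z2R_D) E9 E50 E25 Z2R_nat.
rewrite Z2R_nat E25 in A' B'; set s := n%:R / 2 ^+ 25 in A' B'.
have -> : core (n%:R / 2 ^+ 11) = s * (doubling_sum 19 (expR (- s)) + 1).
  rewrite mulrDr mulr1 doubling_sum_psi /core.
  have -> // : n%:R / 2 ^+ 11 / 2 ^+ 14 = s.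
  by rewrite /s -mulrA -invfM -exprD.
set d := doubling_sum _ _ in A' B' *.
have n0 : 0 <= n%:R :> R by [].
have En : n%:R = s * 2 ^+ 25 by rewrite /s divfK // gt_eqF // exprn_gt0.
have D0 : 0 < S * 2 ^+ 25 by rewrite mulr_gt0 // exprn_gt0.
have T0 : 0 <= 10 ^+ 9 :> R by exact: exprn_ge0.
have key : 10 ^+ 9 * (s * (d + 1)) * (S * 2 ^+ 25) = 10 ^+ 9 * (n%:R * (d * S + S)).
  by rewrite En; ring.
move=> lo1 hi1; apply/andP; split; rewrite -(ler_pM2r D0) key.
  by apply: (le_trans lo1); rewrite ler_wpM2l // ler_wpM2l // lerD2r.
apply: le_trans hi1; by rewrite ler_wpM2l // ler_wpM2l // lerD2r.
Qed.

Lemma Z2R_shift a n : Z2R (a + Z.of_nat n)%ZZ = Z2R a + n%:R.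
Proof. by rewrite Z2R_D Z2R_nat. Qed.

Lemma core_grid n : (2048 <= n <= 4096)%N ->
  Z2R 1442680782 <= 10 ^+ 9 * core (n%:R / 2 ^+ 11) <= Z2R 1442709306.
Proof.
move=> n1; apply: grid_test_core => //.
have := grid_test_fromP grid_test_all (_ : (n - 2048 < 2049)%N) => /(_ ltac:(lia)).
have -> // : (2048 + Z.of_nat (n - 2048))%ZZ = Z.of_nat n by lia.
Qed.

Lemma core_5_4 : 10 ^+ 9 * core (5 / 4) <= Z2R 1442681213.
Proof.
have /andP[_] := @grid_test_core _ _ 2560 isT grid_test_5_4.
by have -> : 2560%:R / 2 ^+ 11 = 5 / 4 :> R by lra.
Qed.

Lemma core_15_8 : Z2R 1442708719 <= 10 ^+ 9 * core (15 / 8).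
Proof.
have /andP[+ _] := @grid_test_core _ _ 3840 isT grid_test_15_8.
by have -> : 3840%:R / 2 ^+ 11 = 15 / 8 :> R by lra.
Qed.

End Grid.

(** * The dyadic sum of s e^-s *)

Section Interp.
Variable R : realType.
Implicit Types x s : R.

Lemma expRN1_le : expR (- 1) <= 3 / 8 :> R.
Proof. have [_ _] := @expRN_taylor R 1 ler01; lra. Qed.

Lemma expRN_nat_le n : expR (- n%:R) <= (3 / 8) ^+ n :> R.
Proof.
rewrite -[n%:R]mulr1 -mulrN expRM_natl lerXn2r ?nnegrE ?expR_ge0 ?expRN1_le //.
Qed.

(** A bound for [|psi''|] on [[2 ^ (i - 14), 2 ^ (i - 13)]], the range of scale [i] in
[core] when [x] runs over [[1, 2]]; beyond 2 the decay of the exponential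
is needed to make the weighted sum of the bounds small. *)
Definition psi2_bound i : R :=
  if (i < 14)%N then 2 else
  if i == 14 then 1 / 2 else 2 * (3 / 8) ^+ (2 + 2 ^ (i - 15)).

Lemma psi2_boundP i s : 2 ^+ i / 2 ^+ 14 <= s <= 2 * (2 ^+ i / 2 ^+ 14) ->
  `|(s - 2) * expR (- s)| <= psi2_bound i.
Proof.
have P0 n : 0 < 2 ^+ n :> R by rewrite exprn_gt0.
move=> /andP[s1 s2]; have s0 : 0 < s by apply: lt_le_trans s1; rewrite divr_gt0.
have e0 := expR_ge0 (- s).
rewrite normrM (ger0_norm e0) /psi2_bound; case: ltnP => i14.
  have le1 : expR (- s) <= 1 by rewrite expR_le1 oppr_le0 ltW.
  have sle2 : s <= 1.
    apply: le_trans s2 _; rewrite mulrA ler_pdivrMr // mul1r -exprS.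
    by rewrite ler_eXn2l // ltr1n.
  by rewrite ler0_norm; [nra | lra].
case: eqP => [i_eq | /eqP i_neq].
  rewrite i_eq divff ?gt_eqF // in s1 s2.
  have := expRN1_le; have : expR (- s) <= expR (- 1) by rewrite ler_expR; lra.
  by rewrite ler0_norm; [nra | lra].
have {i14 i_neq} [j ij] : exists j, i = (15 + j)%N.
  by exists (i - 15)%N; rewrite subnKC // ltn_neqAle eq_sym i_neq.
rewrite ij in s1 s2 *; rewrite addKn.
have {}s1 : 2 * 2 ^+ j <= s.
  by apply: le_trans s1; rewrite ler_pdivlMr // mulrAC -exprS -exprD lexx.
have j1 : 1 <= 2 ^+ j :> R by rewrite exprn_ege1 // ler1n.
rewrite ger0_norm; last lra.
apply: le_trans (_ : 2 * expR (- (2 + 2 ^ j)%:R) <= _).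
  apply: le_trans (_ : 2 * expR (- (2 + s / 2)) <= _).
    have -> : - s = - (2 + s / 2) - (s / 2 - 2) by field.
    rewrite expRD mulrCA [leRHS]mulrC ler_wpM2l ?expR_ge0 //.
    rewrite expRN ler_pdivrMr ?expR_gt0 //.
    have := expR_ge1Dx (s / 2 - 2); lra.
  by rewrite ler_wpM2l // ler_expR lerN2 natrD natrX; lra.
by rewrite ler_wpM2l // expRN_nat_le.
Qed.

Lemma psi2_bound_sum :
  \sum_(i < 20) psi2_bound i * (2 ^+ i / 2 ^+ 14) ^+ 2 <= 4.
Proof.
rewrite !big_ord_recr big_ord0 /psi2_bound /=.
lra.
Qed.

Lemma core_chord a h x : 1 <= a -> 0 < h -> a + h <= 2 -> a <= x <= a + h ->
  `|h * core x - ((a + h - x) * core a + (x - a) * core (a + h))| <= 4 / 8 * h ^+ 3.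
Proof.
move=> a1 h0 ah xab.
pose w (i : nat) : R := 2 ^+ i / 2 ^+ 14.
have w0 i : 0 < w i by rewrite divr_gt0 // exprn_gt0.
have HE y : core y = \sum_(i < 20) psi (y * w i) + y / 2 ^+ 14.
  by congr (_ + _); apply: eq_bigr => i _; congr psi; rewrite /w; ring.
have -> : h * core x - ((a + h - x) * core a + (x - a) * core (a + h)) =
  \sum_(i < 20) (h * psi (x * w i) - ((a + h - x) * psi (a * w i)
                    + (x - a) * psi ((a + h) * w i))).
  rewrite !HE sumrB big_split /= -!mulr_sumr.
  by ring.
apply: (le_trans (ler_norm_sum _ _ _)).
have h3 : 0 <= h ^+ 3 / 8 by rewrite divr_ge0 // exprn_ge0 // ltW.
rewrite mulrAC -mulrA; apply: le_trans (ler_wpM2r h3 psi2_bound_sum).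
rewrite mulr_suml; apply: ler_sum => i _.
have xw : a * w i <= x * w i <= (a + h) * w i by rewrite !ler_pM2r.
have bnd s : a * w i <= s <= (a + h) * w i ->
    `|(s - 2) * expR (- s)| <= psi2_bound i.
  move=> /andP[s1 s2]; apply: psi2_boundP; apply/andP; split.
    by apply: le_trans s1; rewrite -[leLHS]mul1r ler_pM2r.
  by apply: (le_trans s2); rewrite ler_pM2r.
have := psi_chord bnd xw.
have -> : (a + h) * w i - a * w i = h * w i by ring.
have -> : (a + h) * w i - x * w i = (a + h - x) * w i by ring.
rewrite -mulrBl.
have -> : h * w i * psi (x * w i) - ((a + h - x) * w i * psi (a * w i)
    + (x - a) * w i * psi ((a + h) * w i)) =
   (h * psi (x * w i) - ((a + h - x) * psi (a * w i)
                    + (x - a) * psi ((a + h) * w i))) * w i by ring.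
rewrite normrM (ger0_norm (ltW (w0 i))).
have -> : psi2_bound i / 8 * (h * w i) ^+ 3 =
   psi2_bound i * w i ^+ 2 * (h ^+ 3 / 8) * w i by field.
by rewrite ler_pM2r.
Qed.

(** Interpolation between neighbouring grid points, at distance [h = 2 ^ -11], costs
[4 / 8 * h ^ 2], which is less than [120e-9]. *)
Lemma core_bounds x : 1 <= x < 2 ->
  Z2R R 1442680662 <= 10 ^+ 9 * core x <= Z2R R 1442709426.
Proof.
move=> /andP[x1 x2].
have [M [ME M0]] : exists M : R, M = 2 ^+ 11 /\ 0 < M.
  by exists (2 ^+ 11); split; [exact: erefl | rewrite exprn_gt0].
have M2 : M = 2048%:R by rewrite ME -natrX.
have xM0 : 0 <= x * M by rewrite mulr_ge0 ?(ltW M0) // (le_trans ler01).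
have /andP[n1 n2] := truncn_itv xM0.
move: (Num.truncn (x * M)) n1 n2 => n n1 n2.
have n_ge : (2048 <= n)%N.
  by rewrite -ltnS -(ltr_nat R) (le_lt_trans _ n2) // -M2 ler_peMl // ltW.
have n_lt : (n < 4096)%N.
  rewrite -(ltr_nat R) (le_lt_trans n1) // -[4096%N]/(2 * 2048)%N natrM -M2.
  by rewrite ltr_pM2r.
have r1 : (2048 <= n <= 4096)%N by rewrite n_ge ltnW.
have r2 : (2048 <= n.+1 <= 4096)%N by rewrite n_lt (leqW n_ge).
have /andP[g1 g2] := core_grid R r1; have /andP[g3 g4] := core_grid R r2.
rewrite -ME in g1 g2 g3 g4.
have T120 : 10 ^+ 9 * (4 / 8 * M^-1 ^+ 2) <= 120 by rewrite ME; clear; lra.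
pose a := n%:R / M; pose h := M^-1.
have ahE : n.+1%:R / M = a + h by rewrite -addn1 natrD mulrDl mul1r.
rewrite ahE -/a in g1 g2 g3 g4.
have h0 : 0 < h by rewrite invr_gt0.
have a1 : 1 <= a by rewrite ler_pdivlMr // mul1r M2 ler_nat.
have ah2 : a + h <= 2.
  by rewrite -ahE ler_pdivrMr // M2 -natrM ler_nat.
have xa : a <= x by rewrite ler_pdivrMr.
have xb : x <= a + h by rewrite -ahE ler_pdivlMr // ltW.
have := core_chord a1 h0 ah2 (introT andP (conj xa xb)).
have {}T120 : 10 ^+ 9 * (4 / 8 * h ^+ 3) <= 120 * h.
  have -> : 10 ^+ 9 * (4 / 8 * h ^+ 3) = 10 ^+ 9 * (4 / 8 * h ^+ 2) * h by ring.
  by rewrite ler_pM2r.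
rewrite (Z2R_shift R 1442680662 120 : Z2R R 1442680782 = _) in g1 g3.
rewrite (Z2R_shift R 1442709306 120 : Z2R R 1442709426 = _).
have T0 : 0 <= 10 ^+ 9 :> R by exact: exprn_ge0.
move: (Z2R _ _) (Z2R _ _) (10 ^+ 9) T0 T120 g1 g2 g3 g4 => L U T T0 T120 g1 g2 g3 g4.
rewrite ler_norml => /andP[c1 c2].
have {}c1 := ler_wpM2l T0 c1; have {}c2 := ler_wpM2l T0 c2.
rewrite -(subr_ge0 a) in xa; rewrite -subr_ge0 in xb.
have {}g1 := ler_wpM2l xb g1; have {}g2 := ler_wpM2l xb g2.
have {}g3 := ler_wpM2l xa g3; have {}g4 := ler_wpM2l xa g4.
move: g1 g2 g3 g4 c1 c2 T120 h0; clear.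
by move=> g1 g2 g3 g4 c1 c2 T120 h0; apply/andP; split; rewrite -(ler_pM2l h0); lra.
Qed.

End Interp.

Section Tails.
Variable R : realType.
Implicit Types x s y z : R.
Local Notation Z2R := (@Z2R R).

Lemma ln2_test_bounds n1 n2 : (0 <= n1)%ZZ -> (0 <= n2)%ZZ ->
  (2 ^ 13 * n1 <= 8796093022208)%ZZ -> (2 ^ 13 * n2 <= 8796093022208)%ZZ ->
  Z.leb (2 ^ 49) (sqr_iter_lo 13 (expN_lo 8796093022208 n1)) ->
  Z.leb (sqr_iter_hi 13 (expN_lo 8796093022208 n2 + 2)) (2 ^ 49) ->
  Z2R n1 <= 2 ^+ 30 * ln 2 <= Z2R n2.
Proof.
have E43 : Z2R 8796093022208 = 2 ^+ 43 by rewrite -(Z2R_pow _ 2 43).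
have E49 : Z2R (2 ^ 49)%ZZ = 2 ^+ 49 by rewrite -(Z2R_pow _ 2 49).
have P0 : (0 < 8796093022208)%ZZ by [].
move: 8796093022208%ZZ (2 ^ 49)%ZZ E43 E49 P0 => P Q E43 E49 P0.
move=> n10 n20 p1 p2 /Z.leb_le /(@Z2R_le R) + /Z.leb_le /(@Z2R_le R).
rewrite E49.
have [S [SE S0]] : exists S : R, S = 2 ^+ 50 /\ 0 < S.
  by exists (2 ^+ 50); split; [exact: erefl | rewrite exprn_gt0 // ltr0n].
have ES : 2 ^+ 49 = 2^-1 * S by rewrite SE (exprS _ 49) mulKf.
have [a0 A _] := expN_lo_bounds SE n10 p1 P0.
have [_ _ B] := expN_lo_bounds SE n20 p2 P0.
have A' := sqr_iter_lo_le SE 13 a0 A.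
have B' := sqr_iter_hi_ge SE 13 (expR_ge0 _) B.
have EE (n : Z) : expR (- (Z2R n / Z2R P)) ^+ (2 ^ 13) = expR (- (Z2R n / 2 ^+ 30)).
  rewrite -expRM_natl E43 natrX; congr expR.
  by rewrite (_ : 2 ^+ 43 = 2 ^+ 13 * 2 ^+ 30 :> R) -?exprD //; field.
rewrite EE ES in A' *; rewrite EE in B'.
have half : expR (- ln 2) = 2^-1 :> R by rewrite expRN lnK // posrE.
move=> lo hi.
have {}lo := le_trans lo A'; have {}hi := le_trans B' hi.
rewrite ler_pM2r // -half ler_expR lerN2 in lo.
rewrite ler_pM2r // -half ler_expR lerN2 in hi.
have M0 : 0 < 2 ^+ 30 :> R by rewrite exprn_gt0.
by rewrite mulrC -ler_pdivrMr // lo -ler_pdivlMr // hi.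
Qed.

Lemma ln2_bounds : Z2R 744261117 <= 2 ^+ 30 * ln (2 : R) <= Z2R 744261118.
Proof.
have /andP[A B] := ln2_test.
by apply: ln2_test_bounds A B; apply/Z.leb_le; vm_compute.
Qed.

Lemma psi_ge0 s : 0 <= s -> 0 <= psi s.
Proof. by move=> s0; rewrite mulr_ge0 // expR_ge0. Qed.

Lemma psi_le_id s : 0 <= s -> psi s <= s.
Proof. by move=> s0; rewrite ler_piMr // expR_le1 oppr_le0. Qed.

Lemma psi_ge_quad s : 0 <= s -> s - s ^+ 2 <= psi s.
Proof.
move=> s0; have := ler_wpM2l s0 (expR_ge1Dx (- s)); rewrite /psi; lra.
Qed.

Lemma psi_le_expRN s : psi s <= expR (- (s / 2)).
Proof.
have -> : psi s = s * expR (- (s / 2)) * expR (- (s / 2)).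
  by rewrite /psi -mulrA -expRD; congr (_ * expR _); field.
rewrite ler_piMl ?expR_ge0 // expRN ler_pdivrMr ?expR_gt0 // mul1r.
have := expR_ge1Dx (s / 2 - 1); have := expRN1_le R.
by rewrite expRD; have := expR_gt0 (s / 2); nra.
Qed.

(** From [s - s ^ 2 <= psi s <= s] and two geometric series. *)
Lemma low_tail z v : 0 <= z ->
  z * (1 - 2^-1 ^+ v) - z ^+ 2 / 3 <= \sum_(i < v) psi (z * 2^-1 ^+ i.+1)
   <= z * (1 - 2^-1 ^+ v).
Proof.
move=> z0; have [] : z * (1 - 2^-1 ^+ v) - z ^+ 2 / 3 * (1 - 4^-1 ^+ v)
   <= \sum_(i < v) psi (z * 2^-1 ^+ i.+1)
   /\ \sum_(i < v) psi (z * 2^-1 ^+ i.+1) <= z * (1 - 2^-1 ^+ v).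
  elim: v => [|v [IH1 IH2]]; first by rewrite big_ord0 !expr0; split; lra.
  rewrite big_ord_recr /=.
  have s0 : 0 <= z * 2^-1 ^+ v.+1 by rewrite mulr_ge0 // exprn_ge0 // invr_ge0.
  have := psi_ge_quad s0; have := psi_le_id s0.
  rewrite exprMn -exprM mulnC exprM (_ : 2^-1 ^+ 2 = 4^-1); last by field.
  rewrite !(exprS _ v); split; lra.
have : 0 <= 4^-1 ^+ v :> R by rewrite exprn_ge0 // invr_ge0.
have := sqr_ge0 z; move=> z2 q0 A B; apply/andP; split => //.
by apply: le_trans A; nra.
Qed.

(** The first term is at most [exp (- 32) <= (3 / 8) ^ 32], and the bounds at least halve at
each further scale. *)
Lemma high_tail x m : 1 <= x ->
  0 <= \sum_(i < m) psi (x * 2 ^+ (6 + i)) <= 2 * (3 / 8) ^+ 32.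
Proof.
move=> x1; apply/andP; split.
  by apply: sumr_ge0 => i _; rewrite psi_ge0 // mulr_ge0 ?exprn_ge0 //; lra.
have c0 : 0 <= (3 / 8) ^+ 32 :> R by rewrite exprn_ge0.
apply: le_trans (_ : 2 * (3 / 8) ^+ 32 * (1 - 2^-1 ^+ m) <= _); last first.
  have : 0 <= 2^-1 ^+ m :> R by rewrite exprn_ge0 // invr_ge0.
  nra.
elim: m => [|m IH]; first by rewrite big_ord0 expr0 subrr mulr0.
rewrite big_ord_recr /=; apply: le_trans (lerD IH (_ : _ <= (3 / 8) ^+ 32 * 2^-1 ^+ m)) _.
  apply: (le_trans (psi_le_expRN _)).
  apply: le_trans (_ : expR (- (32 + m)%:R) <= _).
    rewrite ler_expR lerN2 ler_pdivlMr //.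
    apply: le_trans (_ : 2 ^+ (6 + m) <= _); last by rewrite ler_peMl // exprn_ge0.
    rewrite -natrX -natrM ler_nat; have : (m < 2 ^ m)%N by rewrite ltn_expl.
    by rewrite expnD; lia.
  apply: (le_trans (expRN_nat_le _ _)); rewrite exprD ler_wpM2l //.
  by rewrite lerXn2r ?nnegrE //; lra.
rewrite (exprS _ m); have : 0 <= 2^-1 ^+ m :> R by rewrite exprn_ge0 // invr_ge0.
lra.
Qed.

Definition dyadic_sum N y := \sum_(i < N) psi (y / 2 ^+ i).

(** Of the [m + (20 + v)] scales the [m] topmost ones and the [v] lowest ones are the two
tails.  The lower tail falls short of its linearisation by at most 6 units of [1e-9], and the
upper one is below one unit. *)
Lemma dyadic_sum_core x m v : 1 <= x <= 2 -> (20 <= v)%N ->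
  10 ^+ 9 * core x - 6 <= 10 ^+ 9 * dyadic_sum (m + (20 + v)) (x * 2 ^+ (5 + m))
   <= 10 ^+ 9 * core x + 1.
Proof.
move=> /andP[x1 x2] v20.
have P0 n : 2 ^+ n != 0 :> R by rewrite expf_neq0.
rewrite /dyadic_sum 2!big_split_ord /=.
rewrite (reindex_inj rev_ord_inj) /=.
rewrite [X in _ + (X + _)](reindex_inj rev_ord_inj) /=.
have -> : \sum_(i < m) psi (x * 2 ^+ (5 + m) / 2 ^+ (m - i.+1)) =
          \sum_(i < m) psi (x * 2 ^+ (6 + i)).
  apply: eq_bigr => i _; congr psi.
  rewrite (_ : 5 + m = 6 + i + (m - i.+1))%N; last by have := ltn_ord i; lia.
  by rewrite exprD mulrA mulfK.
have -> : \sum_(i < 20) psi (x * 2 ^+ (5 + m) / 2 ^+ (m + (20 - i.+1))) =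
          \sum_(i < 20) psi (x / 2 ^+ 14 * 2 ^+ i).
  apply: eq_bigr => i _; congr psi.
  have -> : 2 ^+ (5 + m) = 2 ^+ (m + (20 - i.+1)) / 2 ^+ 14 * 2 ^+ i :> R.
    apply: (mulIf (P0 14)); rewrite [RHS]mulrAC divfK // -!exprD; congr (_ ^+ _).
    by have := ltn_ord i; lia.
  by field; rewrite P0.
have -> : \sum_(i < v) psi (x * 2 ^+ (5 + m) / 2 ^+ (m + (20 + i))) =
          \sum_(i < v) psi (x / 2 ^+ 14 * 2^-1 ^+ i.+1).
  apply: eq_bigr => i _; congr psi; rewrite exprVn.
  have -> : 2 ^+ (m + (20 + i)) = 2 ^+ (5 + m) * 2 ^+ 14 * 2 ^+ i.+1 :> R.
    by rewrite -!exprD; congr (_ ^+ _); lia.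
  by field; rewrite !P0.
have /andP[A1 A2] := high_tail m x1.
have z0 : 0 <= x / 2 ^+ 14 by rewrite divr_ge0 //; lra.
have /andP[C1 C2] := low_tail v z0.
have v20' : 2^-1 ^+ v <= 2^-1 ^+ 20 :> R.
  by rewrite ler_wiXn2l // ?invr_ge0 // invf_le1 // ler1n.
have v0 : 0 <= 2^-1 ^+ v :> R by rewrite exprn_ge0 // invr_ge0.
have -> : \sum_(i < 20) psi (x / 2 ^+ 14 * 2 ^+ i) = core x - x / 2 ^+ 14.
  by rewrite /core addrK.
move: (\sum_(i < m) _) (\sum_(i < v) _) A1 A2 C1 C2 => A C A1 A2 C1 C2.
have s38 : 10 ^+ 9 * (2 * (3 / 8) ^+ 32) <= 1 :> R by lra.
have zle : 10 ^+ 9 * (x / 2 ^+ 14 * 2^-1 ^+ v + (x / 2 ^+ 14) ^+ 2 / 3) <= 6.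
  have z2 : x / 2 ^+ 14 <= 2^-1 ^+ 13 by lra.
  apply: le_trans (_ : 10 ^+ 9 * (2^-1 ^+ 13 * 2^-1 ^+ 20 + (2^-1 ^+ 13) ^+ 2 / 3) <= _).
    rewrite ler_wpM2l ?exprn_ge0 //; apply: lerD; first by apply: ler_pM.
    by rewrite ler_pM2r ?invr_gt0 // lerXn2r ?nnegrE // exprn_ge0 // invr_ge0.
  by lra.
have T0 : 0 <= 10 ^+ 9 :> R by exact: exprn_ge0.
move: (core x) (x / 2 ^+ 14) (10 ^+ 9) T0 (2 * (3 / 8) ^+ 32) s38 A2 zle z0 C1 C2.
move=> h z T T0 e s38 A2 zle z0 C1 C2.
have zv : 0 <= z * 2^-1 ^+ v by rewrite mulr_ge0.
have B1 : h - z * 2^-1 ^+ v - z ^+ 2 / 3 <= A + (h - z + C) by lra.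
have B2 : A + (h - z + C) <= h + e by lra.
have := ler_wpM2l T0 B1; have := ler_wpM2l T0 B2.
by move=> D1 D2; apply/andP; split; lra.
Qed.

Lemma dyadic_sum_bounds x m v : 1 <= x < 2 -> (20 <= v)%N ->
  Z2R 1442680656 <= 10 ^+ 9 * dyadic_sum (m + (20 + v)) (x * 2 ^+ (5 + m))
   <= Z2R 1442709427.
Proof.
move=> /andP[x1 x2] v20; have := core_bounds (introT andP (conj x1 x2)).
have := dyadic_sum_core m (introT andP (conj x1 (ltW x2))) v20.
rewrite (Z2R_shift R 1442680656 6 : Z2R 1442680662 = _).
rewrite (Z2R_shift R 1442709426 1 : Z2R 1442709427 = _).
move: (Z2R _) (Z2R _) (10 ^+ 9 * _) (10 ^+ 9 * _) => L U d c; clear.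
by move=> /andP[d1 d2] /andP[c1 c2]; apply/andP; split; lra.
Qed.

Lemma dyadic_sum_ln2 x m v : 1 <= x < 2 -> (20 <= v)%N ->
  `|ln 2 * dyadic_sum (m + (20 + v)) (x * 2 ^+ (5 + m)) - 1| < 10 ^- 5.
Proof.
move=> x12 v20; have /andP[g1 g2] := dyadic_sum_bounds m x12 v20.
have /andP[l1 l2] := ln2_bounds.
move: (dyadic_sum _ _) g1 g2 => g g1 g2.
have pos (z : Z) : (0 <= z)%ZZ -> 0 <= Z2R z by exact: Z2R_le.
have p1 := pos 744261117%ZZ ltac:(lia); have p2 := pos 1442680656%ZZ ltac:(lia).
have lo := ler_pM p1 p2 l1 g1.
have hi := ler_pM (le_trans p1 l1) (le_trans p2 g1) l2 g2.
have E : 2 ^+ 30 * ln 2 * (10 ^+ 9 * g) = ln 2 * g * (10 ^+ 9 * 2 ^+ 30) by ring.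
rewrite E -(Z2R_M _ 744261117 1442680656) in lo.
rewrite E -(Z2R_M _ 744261118 1442709427) in hi.
have [T [TE T0]] : exists T : R, T = 10 ^+ 9 * 2 ^+ 30 /\ 0 < T.
  by exists (10 ^+ 9 * 2 ^+ 30); split; [exact: erefl | rewrite mulr_gt0 ?exprn_gt0].
rewrite -TE in lo hi.
have [P [PE P0]] : exists P : R, P = 10 ^+ 5 /\ 0 < P.
  by exists (10 ^+ 5); split; [exact: erefl | rewrite exprn_gt0].
have ZP : Z2R (10 ^ 5)%ZZ = P by rewrite PE (Z2R_pow _ 10 5).
have ZT : Z2R (10 ^ 9 * 2 ^ 30)%ZZ = T.
  by rewrite TE Z2R_M (Z2R_pow _ 10 9) (Z2R_pow _ 2 30).
have hi' : Z2R (744261118 * 1442709427 * 10 ^ 5)%ZZ < Z2R (10 ^ 9 * 2 ^ 30 * (10 ^ 5 + 1))%ZZ.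
  by apply: Z2R_lt; apply/Z.ltb_lt; vm_compute.
have lo' : Z2R (10 ^ 9 * 2 ^ 30 * (10 ^ 5 - 1))%ZZ < Z2R (744261117 * 1442680656 * 10 ^ 5)%ZZ.
  by apply: Z2R_lt; apply/Z.ltb_lt; vm_compute.
rewrite Z2R_M [in ltRHS]Z2R_M Z2R_D ZT ZP in hi'.
rewrite Z2R_M [in ltRHS]Z2R_M Z2R_B ZT ZP in lo'.
have {}hi := le_lt_trans (ler_wpM2r (ltW P0) hi) hi'.
have {}lo := lt_le_trans lo' (ler_wpM2r (ltW P0) lo).
rewrite -[Z2R 1]/(1 : R) in lo hi.
have -> : 10 ^- 5 = P^-1 :> R by rewrite PE.
move: (ln 2 * g) lo hi T0 P0; clear => t lo hi T0 P0.
have {}lo : P - 1 < t * P by rewrite -(ltr_pM2l T0); lra.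
have {}hi : t * P < P + 1 by rewrite -(ltr_pM2l T0); lra.
have rP : P^-1 * P = 1 by rewrite mulVf // gt_eqF.
rewrite ltr_norml; apply/andP; split; rewrite -(ltr_pM2r P0); lra.
Qed.
End Tails.

(** * Comparison of the divisor count with the dyadic sum *)

Lemma d2_target_rev k : (2 < k)%N ->
  d2 (2 ^ k - 3) = (2 + \sum_(i < k - 3) accepted (i + 3) 1 (k - 4 - i))%N.
Proof.
move=> k2; rewrite d2_target //; congr (_ + _)%N.
rewrite (reindex_inj rev_ord_inj) /=; apply: eq_bigr => i _.
by congr (accepted _ _ _); have := ltn_ord i; lia.
Qed.

Lemma linear_le_expn e : (5 <= e)%N -> (4 * e + 5 <= 2 ^ e)%N.
Proof.
move=> e5; have [d ->] : exists d, e = (d + 5)%N by exists (e - 5)%N; lia.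
by elim: d => [//|d IH]; rewrite addSn (expnS 2 (d + 5)); lia.
Qed.

Lemma square_le_expn k : (4 <= k)%N -> (k ^ 2 <= 2 ^ k)%N.
Proof.
move=> k4; have [d ->] : exists d, k = (d + 4)%N by exists (k - 4)%N; lia.
elim: d => [//|d IH]; rewrite addSn (expnS 2 (d + 4)); move: IH.
rewrite -!mulnn; nia.
Qed.

Section Sum.
Variable R : realType.

(** For [l = i + 3 <= 7] the proportion of accepted words is at most
[(255 / 256) ^ a], [a] the integral part of [n / 8], which beats the powers of [k] in front. *)
Lemma small_decay i k : (i < 5)%N -> (32 <= k)%N ->
  5 * k%:R * (accepted (i + 3) 1 (k - 4 - i))%:R / 2 ^+ k <= 2 ^+ 25 / k%:R :> R.
Proof.
move=> i5 k32; set n := (k - 4 - i)%N.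
have k0 : 0 < k%:R :> R by rewrite ltr0n; lia.
have nE := divn_eq n 8; set a := (n %/ 8)%N in nE; set b := (n %% 8)%N in nE.
have b8 : (b < 8)%N by rewrite ltn_mod.
have kE : (k = n + (i + 4))%N by rewrite /n; lia.
have ka : (k <= 16 * a)%N by lia.
have := @accepted_decay (i + 3) a b 1 ltac:(lia); rewrite -nE => C.
have {}C : (accepted (i + 3) 1 n)%:R <= 255 ^+ a * 2 ^+ b :> R.
  by rewrite -!natrX -natrM ler_nat.
have [B [BE B0]] : exists B : R, B = 256 /\ 0 < B.
  by exists 256; split; [exact: erefl | rewrite ltr0n].
have [c [cE /andP[c0 c1]]] : exists c : R, c = 255 / B /\ 0 <= c <= 1 - B^-1.
  by exists (255 / B); split; [exact: erefl | rewrite BE; clear; lra].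
have E : 2 ^+ k = B ^+ a * 2 ^+ b * 2 ^+ (i + 4) :> R.
  rewrite kE {1}nE !exprD mulnC exprM; congr (_ ^+ _ * _ * _); rewrite BE; clear; ring.
have P0 m : 0 < 2 ^+ m :> R by rewrite exprn_gt0.
have Q0 : 0 < B ^+ a :> R by rewrite exprn_gt0.
rewrite E.
apply: le_trans (_ : 5 * k%:R * c ^+ a / 2 ^+ 4 <= _).
  rewrite cE expr_div_n ler_pdivrMr ?mulr_gt0 // -!mulrA ler_pM2l // ler_pM2l //.
  apply: (le_trans C); rewrite exprD.
  have -> : (255 ^+ a * ((B ^+ a)^-1 * ((2 ^+ 4)^-1 * (B ^+ a * (2 ^+ b * (2 ^+ i * 2 ^+ 4)))))
    = 255 ^+ a * 2 ^+ b * 2 ^+ i :> R) by field; rewrite !gt_eqF.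
  apply: ler_peMr; last by rewrite exprn_ege1 ?ler1n.
  by apply: mulr_ge0; apply: exprn_ge0; exact: ler0n.
have e1 : c ^+ a <= expR (- (a%:R / B)) :> R.
  rewrite -mulrN expRM_natl lerXn2r ?nnegrE ?expR_ge0 //.
  by apply: (le_trans c1); exact: expR_ge1Dx.
have a0 : 0 <= a%:R / B :> R by rewrite divr_ge0 ?ler0n // ltW.
have [e2 _] := expR_ge_cube a0.
have ka' : k%:R <= 16 * a%:R :> R by rewrite -natrM ler_nat.
have ap : 0 < a%:R :> R by lra.
have e3 : expR (- (a%:R / B)) <= 2 ^+ 17 / a%:R ^+ 2 :> R.
  rewrite expRN ler_pdivlMr ?exprn_gt0 // mulrC ler_pdivrMr ?expR_gt0 //.
  by move: e2; rewrite BE; clear; lra.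
apply: le_trans (_ : 5 * k%:R * (2 ^+ 17 / a%:R ^+ 2) / 2 ^+ 4 <= _).
  rewrite ler_pM2r ?invr_gt0 // ler_wpM2l ?mulr_ge0 // ?(ltW k0) //.
  exact: le_trans e1 e3.
have kk : k%:R ^+ 2 <= (16 * a%:R) ^+ 2 :> R by rewrite lerXn2r // nnegrE // mulr_ge0.
rewrite ler_pdivlMr //.
have -> : 5 * k%:R * (2 ^+ 17 / a%:R ^+ 2) / 2 ^+ 4 * k%:R =
  5 * 2 ^+ 13 * (k%:R ^+ 2) / a%:R ^+ 2 :> R by field; rewrite gt_eqF.
rewrite ler_pdivrMr ?exprn_gt0 //; have := sqr_ge0 (a%:R : R); lra.
Qed.

Lemma psi_decay x : 0 < x -> psi x <= 2 / x :> R.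
Proof.
move=> x0; rewrite /psi expRN; have [A _] := expR_ge_cube (ltW x0).
have e0 := expR_gt0 x.
by rewrite ler_pdivlMr // mulrAC ler_pdivrMr //; lra.
Qed.

Definition divisor_term k i : R := 5 * k%:R * (accepted (i + 3) 1 (k - 4 - i))%:R / 2 ^+ k.
Definition limit_term k i : R := psi (5 * k%:R / 2 ^+ (i + 5)).

Lemma term_small i k : (i < 5)%N -> (32 <= k)%N ->
  `|divisor_term k i - limit_term k i| <= 2 ^+ 26 / k%:R.
Proof.
move=> i5 k32; have k0 : 0 < k%:R :> R by rewrite ltr0n; lia.
have t1 := small_decay i5 k32; rewrite -/(divisor_term k i) in t1.
have t0 : 0 <= divisor_term k i by rewrite divr_ge0 ?exprn_ge0 ?mulr_ge0.
have x0 : 0 < 5 * k%:R / 2 ^+ (i + 5) :> R by rewrite divr_gt0 ?exprn_gt0 ?mulr_gt0.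
have p1 := psi_decay x0; have p0 := psi_ge0 (ltW x0).
rewrite -/(limit_term k i) in p0 p1.
have p2 : limit_term k i <= 2 ^+ 25 / k%:R.
  apply: (le_trans p1); rewrite ler_pdivlMr //.
  have -> : 2 / (5 * k%:R / 2 ^+ (i + 5)) * k%:R = 2 / 5 * 2 ^+ (i + 5) :> R.
    by field; rewrite ?gt_eqF ?exprn_gt0.
  have : 2 ^+ (i + 5) <= 2 ^+ 10 :> R by rewrite ler_eXn2l ?ltr1n //; lia.
  lra.
rewrite (exprS _ 25) -mulrA ler_norml; apply/andP; split; lra.
Qed.

Lemma term_large i k : (i < k - 3)%N ->
  `|divisor_term k i - limit_term k i| <= 5 * k%:R / 2 ^+ (i + 4).
Proof.
move=> ik; set n := (k - 4 - i)%N.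
have kE : (k = n + (i + 4))%N by rewrite /n; lia.
have P0 m : 0 < 2 ^+ m :> R by rewrite exprn_gt0.
have t0 : 0 <= divisor_term k i by rewrite divr_ge0 ?exprn_ge0 ?mulr_ge0.
have C : (accepted (i + 3) 1 n)%:R <= 2 ^+ n :> R by rewrite -natrX ler_nat accepted_le.
have t1 : divisor_term k i <= 5 * k%:R / 2 ^+ (i + 4).
  rewrite /divisor_term -/n {2}kE exprD -mulrA ler_wpM2l ?mulr_ge0 //.
  rewrite ler_pdivrMr ?mulr_gt0 // mulrC mulfK ?gt_eqF //.
have x0 : 0 <= 5 * k%:R / 2 ^+ (i + 5) :> R by rewrite divr_ge0 ?mulr_ge0 // ltW.
have p1 := psi_le_id x0; have p0 := psi_ge0 x0.
have x1 : 5 * k%:R / 2 ^+ (i + 5) <= 5 * k%:R / 2 ^+ (i + 4) :> R.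
  by rewrite ler_wpM2l ?mulr_ge0 // lef_pV2 ?posrE // ler_eXn2l ?ltr1n // leq_add2l.
rewrite /limit_term in p0 p1 *.
by rewrite ler_norml; apply/andP; split; lra.
Qed.

(** The bound [i < 2 * e - 1] keeps [l] small compared to the length of the words, as
[term_error] requires. *)
Lemma term_mid e i k : (5 <= e)%N -> (2 ^ e <= k)%N -> (5 <= i < 2 * e - 1)%N ->
  `|divisor_term k i - limit_term k i| <= 1000 * (2 * e%:R + 5) / k%:R.
Proof.
move=> e5 ek /andP[i5 ie].
have k4 := leq_trans (linear_le_expn e5) ek.
have h1 : (8 <= i + 3)%N by lia.
have h2 : (k - 4 - i + (i + 3).+1 = k)%N by lia.
have h3 : (i + 3 + 2 <= k - 4 - i)%N by lia.
have := @term_error R (i + 3) (k - 4 - i) k h1 h2 h3.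
rewrite -/(divisor_term k i) (_ : (i + 3).+2 = i + 5)%N; last lia.
rewrite -/(limit_term k i) => /le_trans; apply.
have k0 : 0 < k%:R :> R by rewrite ltr0n; lia.
have i2 : i%:R + 2 <= 2 * e%:R :> R by rewrite -natrD -natrM ler_nat; lia.
rewrite ler_pM2r ?invr_gt0 ?k0 // (natrD _ i 3); lra.
Qed.

(** For [2 ^ e <= k < 2 ^ (e + 1)], each of the [2 * e - 1] first terms is [O(e / k)];
the others are bounded by a geometric series whose first term is already [O(1 / k)]. *)
Lemma sum_error e k : (5 <= e)%N -> (2 ^ e <= k < 2 ^ e.+1)%N ->
  \sum_(i < k - 3) `|divisor_term k i - limit_term k i|
   <= (2 * e%:R + 5) ^+ 2 * 2 ^+ 26 / k%:R + 20 / k%:R.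
Proof.
move=> e5 /andP[ek ke].
have k4 := leq_trans (linear_le_expn e5) ek.
have k32 : (32 <= k)%N by apply: leq_trans ek; rewrite (@leq_exp2l 2 5).
have k0 : 0 < k%:R :> R by rewrite ltr0n; lia.
have P0 m : 0 < 2 ^+ m :> R by rewrite exprn_gt0.
have [r rE] : exists r, (k - 3 = (2 * e - 1) + r)%N by exists (k - 3 - (2 * e - 1))%N; lia.
rewrite rE big_split_ord /=; apply: lerD.
  apply: le_trans (_ : \sum_(i < 2 * e - 1) (2 * e%:R + 5) * 2 ^+ 26 / k%:R <= _).
    apply: ler_sum => i _; have e0 : 5 <= e%:R :> R by rewrite ler_nat.
    have [i5|i5] := ltnP i 5.
      apply: (le_trans (term_small i5 k32)).
      rewrite ler_pM2r ?invr_gt0 // ler_peMl ?(ltW (P0 _)) //; lra.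
    apply: le_trans (term_mid e5 ek _) _; first by rewrite i5 ltn_ord.
    rewrite ler_pM2r ?invr_gt0 // mulrC ler_wpM2l //; lra.
  rewrite sumr_const card_ord -[leLHS]mulr_natl natrB; last lia.
  have w0 : 0 <= 2 ^+ 26 / k%:R :> R by rewrite divr_ge0 // ltW.
  rewrite natrM -[leRHS]mulrA -[(_ + 5) * 2 ^+ 26 / _]mulrA mulrA ler_wpM2r //.
  by have : 0 <= e%:R :> R by []; nra.
apply: le_trans (_ : \sum_(j < r) 5 * k%:R / 2 ^+ (2 * e + 3) * 2^-1 ^+ j <= _).
  apply: ler_sum => j _; apply: le_trans (term_large _) _; first by have := ltn_ord j; lia.
  have -> : (2 * e - 1 + j + 4 = 2 * e + 3 + j)%N by lia.
  by rewrite exprD invfM exprVn mulrA.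
rewrite -mulr_sumr.
have geo : \sum_(j < r) 2^-1 ^+ j <= 2 :> R.
  have : \sum_(j < r) 2^-1 ^+ j = 2 * (1 - 2^-1 ^+ r) :> R.
    elim: (r) => [|m IH]; first by rewrite big_ord0 expr0 subrr mulr0.
    by rewrite big_ord_recr /= IH exprS; field.
  move=> ->; have : 0 <= 2^-1 ^+ r :> R by rewrite exprn_ge0 // invr_ge0.
  lra.
apply: le_trans (ler_wpM2l _ geo) _.
  by rewrite divr_ge0 ?mulr_ge0 // ltW.
have kk : k%:R ^+ 2 <= 2 ^+ (2 * e + 2) :> R.
  rewrite -!natrX ler_nat (_ : 2 * e + 2 = e.+1 * 2)%N; last lia.
  by rewrite expnM leq_exp2r // ltnW.
rewrite ler_pdivlMr // addnS exprS.
have -> : 5 * k%:R / (2 * 2 ^+ (2 * e + 2)) * 2 * k%:R = 5 * (k%:R ^+ 2 / 2 ^+ (2 * e + 2)) :> R.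
  by field; rewrite gt_eqF.
have : k%:R ^+ 2 / 2 ^+ (2 * e + 2) <= 1 :> R by rewrite ler_pdivrMr // mul1r.
lra.
Qed.

Definition scaled_d2 k : R := 5 * k%:R * (d2 (2 ^ k - 3))%:R / 2 ^+ k.
Definition limit_sum k : R := dyadic_sum (k - 2) (5 * k%:R / 2 ^+ 5).

Lemma scaled_d2_error e k : (5 <= e)%N -> (2 ^ e <= k < 2 ^ e.+1)%N ->
  `|scaled_d2 k - limit_sum k| <= (2 * e%:R + 5) ^+ 2 * 2 ^+ 27 / k%:R.
Proof.
move=> e5 ek; have serr := sum_error e5 ek.
have k32 : (32 <= k)%N.
  by case/andP: ek => ek _; apply: leq_trans ek; rewrite (@leq_exp2l 2 5).
have k0 : 0 < k%:R :> R by rewrite ltr0n; lia.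
have P0 m : 0 < 2 ^+ m :> R by rewrite exprn_gt0.
have kk : k%:R ^+ 2 <= 2 ^+ k :> R.
  rewrite -!natrX ler_nat square_le_expn //; lia.
have kk1 : k%:R / 2 ^+ k <= k%:R^-1 :> R.
  by rewrite ler_pdivrMr // ler_pdivlMl // -expr2.
have -> : scaled_d2 k = 10 * (k%:R / 2 ^+ k) + \sum_(i < k - 3) divisor_term k i.
  rewrite /scaled_d2 d2_target_rev; last lia.
  rewrite natrD natr_sum mulrDr mulrDl; congr (_ + _); first by field; rewrite gt_eqF.
  by rewrite mulr_sumr mulr_suml.
have -> : limit_sum k = \sum_(i < k - 3) limit_term k i + limit_term k (k - 3).
  have shift i : psi (5 * k%:R / 2 ^+ 5 / 2 ^+ i) = limit_term k i.
    by rewrite /limit_term (exprD _ i 5); congr psi; field; rewrite gt_eqF.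
  rewrite /limit_sum /dyadic_sum (_ : k - 2 = (k - 3).+1)%N; last lia.
  rewrite big_ord_recr /=; congr (_ + _).
    by apply: eq_bigr => i _; exact: shift.
  exact: shift.
have q0 : 0 <= k%:R / 2 ^+ k :> R by rewrite divr_ge0 // ltW.
have x0 : 0 <= 5 * k%:R / 2 ^+ (k - 3 + 5) :> R by rewrite divr_ge0 ?mulr_ge0 // ltW.
have last_ge : 0 <= limit_term k (k - 3) by exact: psi_ge0.
have last_le : limit_term k (k - 3) <= 5 * (k%:R / 2 ^+ k).
  apply: le_trans (psi_le_id x0) _; rewrite -mulrA ler_wpM2l // ler_wpM2l //.
  by rewrite lef_pV2 ?posrE // ler_eXn2l ?ltr1n //; lia.
have -> : 10 * (k%:R / 2 ^+ k) + \sum_(i < k - 3) divisor_term k i -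
    (\sum_(i < k - 3) limit_term k i + limit_term k (k - 3)) =
    (10 * (k%:R / 2 ^+ k) - limit_term k (k - 3)) + \sum_(i < k - 3) (divisor_term k i - limit_term k i).
  by rewrite sumrB; ring.
apply: le_trans (ler_normD _ _) _.
apply: le_trans (lerD (_ : _ <= 10 / k%:R) (ler_norm_sum _ _ _)) _.
  by rewrite ler_norml; apply/andP; split; lra.
apply: le_trans (lerD (lexx _) serr) _.
rewrite (exprS _ 26).
have e0 : 5 <= e%:R :> R by rewrite ler_nat.
have : 30 <= (2 * e%:R + 5) ^+ 2 * 2 ^+ 26 :> R.
  have : 225 <= (2 * e%:R + 5) ^+ 2 :> R by nra.
  lra.
move=> H; rewrite -!mulrDl; rewrite ler_pM2r ?invr_gt0 //; lra.
Qed.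
End Sum.

(** * The fluctuation *)

Section Final.
Variable R : realType.

Lemma error_tends (e : nat) : (5 <= e)%N ->
  (2 * e%:R + 5) ^+ 2 / 2 ^+ e <= 100 / e%:R :> R.
Proof.
move=> e5; have e0 : 0 < e%:R :> R by rewrite ltr0n; lia.
rewrite ler_pdivlMr // mulrAC ler_pdivrMr ?exprn_gt0 //.
suff H : ((2 * e + 5) ^ 2 * e <= 100 * 2 ^ e)%N.
  move: H; rewrite -(ler_nat R) (natrM _ (_ ^ 2)) (natrM _ 100) !natrX natrD natrM.
  by [].
have [d ->] : exists d, e = (d + 5)%N by exists (e - 5)%N; lia.
elim: d => [//|d IH]; rewrite addSn (expnS 2 (d + 5)); move: IH.
rewrite -!mulnn; nia.
Qed.

(** Writing [5 * k = x * 2 ^ f], the scales above and below [x] number [f - 10] and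
[k - 12 - f] beyond the twenty central ones; for [k >= 256] there are enough of
both. *)
Lemma limit_sum_split k : (256 <= k)%N ->
  exists x m v, [/\ (20 <= v)%N, (1 : R) <= x < 2, (k - 2 = m + (20 + v))%N &
    5 * k%:R / 2 ^+ 5 = x * 2 ^+ (5 + m)].
Proof.
move=> k256; have k0 : (0 < 5 * k)%N by lia.
have /andP[f1 f2] := trunc_log_bounds (isT : (1 < 2)%N) k0.
set f := trunc_log 2 (5 * k) in f1 f2.
have f10 : (10 <= f)%N.
  rewrite leqNgt; apply/negP => f9; have : (2 ^ f.+1 <= 2 ^ 10)%N by rewrite leq_exp2l.
  by move=> H; have := leq_trans f2 H; rewrite (_ : 2 ^ 10 = 1024)%N //; lia.
have fk : (f + 32 <= k)%N.
  rewrite leqNgt; apply/negP => fk.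
  have h1 : (2 ^ (f./2 + f./2) <= 5 * k)%N.
    by apply: leq_trans f1; rewrite leq_exp2l // addnn -{2}(odd_double_half f) leq_addl.
  have h2 : (f./2 < 2 ^ f./2)%N by rewrite ltn_expl.
  have h3 : (k <= f./2 * 2 + 33)%N by have := odd_double_half f; lia.
  by rewrite expnD in h1; nia.
have P0 n : 0 < 2 ^+ n :> R by rewrite exprn_gt0.
exists (5 * k%:R / 2 ^+ f), (f - 10)%N, (k - 12 - f)%N; split; [lia| |lia|].
  rewrite ler_pdivlMr // mul1r ltr_pdivrMr // -exprS -(natrM R 5 k) -!natrX.
  by rewrite ler_nat ltr_nat f1 f2.
have -> : (5 + (f - 10) = f - 5)%N by lia.
have -> : 2 ^+ f = 2 ^+ 5 * 2 ^+ (f - 5) :> R by rewrite -exprD; congr (_ ^+ _); lia.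
by field; rewrite !gt_eqF.
Qed.

Lemma limit_sum_ln2 k : (256 <= k)%N -> `|ln 2 * limit_sum R k - 1| < 10 ^- 5.
Proof.
move=> k256; have [x [m [v [v20 x12 kE yE]]]] := limit_sum_split k256.
by rewrite /limit_sum kE yE; exact: dyadic_sum_ln2.
Qed.

(** The value 0 below 256, where there may be too few scales, makes the bound [1e-5]
hold at every index. *)
Definition fluctuation k : R := if (k < 256)%N then 0 else ln 2 * limit_sum R k - 1.

Lemma fluctuationE k : (256 <= k)%N -> fluctuation k = ln 2 * limit_sum R k - 1.
Proof. by move=> k256; rewrite /fluctuation ltnNge k256. Qed.

Lemma fluctuation_small k : `|fluctuation k| < 10 ^- 5.
Proof.
rewrite /fluctuation; case: ltnP => k256; last exact: limit_sum_ln2.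
by rewrite normr0 invr_gt0 exprn_gt0.
Qed.

Lemma ln2_gt0 : 0 < ln 2 :> R.
Proof. by rewrite ln_gt0 // ltr1n. Qed.

Lemma limit_sum_5_4 e : (32 <= e)%N ->
  10 ^+ 9 * limit_sum R (2 ^ e) <= Z2R R 1442681214.
Proof.
move=> e32; have e_lt : (e + 40 <= 2 ^ e)%N by have := @linear_le_expn e ltac:(lia); lia.
have x12 : 1 <= (5 / 4 : R) <= 2 by lra.
have v20 : (20 <= 2 ^ e - 2 - 20 - (e - 8))%N by lia.
have := dyadic_sum_core (e - 8) x12 v20.
rewrite (_ : (e - 8 + (20 + (2 ^ e - 2 - 20 - (e - 8))) = 2 ^ e - 2)%N); last lia.
have -> : 5 / 4 * 2 ^+ (5 + (e - 8)) = 5 * (2 ^ e)%N%:R / 2 ^+ 5 :> R.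
  rewrite natrX (_ : e = (e - 8) + 8)%N; last lia.
  by rewrite addnK !exprD; lra.
rewrite -/(limit_sum R (2 ^ e)) => /andP[_].
rewrite (Z2R_shift R 1442681213 1 : Z2R R 1442681214 = _).
move: (Z2R _ _) (core_5_4 R) => L A B; exact: le_trans B (lerD A (lexx _)).
Qed.

Lemma limit_sum_15_8 e : (32 <= e)%N ->
  Z2R R 1442708713 <= 10 ^+ 9 * limit_sum R (3 * 2 ^ e).
Proof.
move=> e32; have e_lt : (e + 40 <= 2 ^ e)%N by have := @linear_le_expn e ltac:(lia); lia.
have x12 : 1 <= (15 / 8 : R) <= 2 by lra.
have v20 : (20 <= 3 * 2 ^ e - 2 - 20 - (e - 7))%N by lia.
have := dyadic_sum_core (e - 7) x12 v20.
rewrite (_ : (e - 7 + (20 + (3 * 2 ^ e - 2 - 20 - (e - 7))) = 3 * 2 ^ e - 2)%N); last lia.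
have -> : 15 / 8 * 2 ^+ (5 + (e - 7)) = 5 * (3 * 2 ^ e)%N%:R / 2 ^+ 5 :> R.
  rewrite natrM natrX (_ : e = (e - 7) + 7)%N; last lia.
  by rewrite addnK !exprD; lra.
rewrite -/(limit_sum R (3 * 2 ^ e)) => /andP[+ _].
move=> A; apply: le_trans A; have := core_15_8 R.
rewrite (Z2R_shift R 1442708713 6 : Z2R R 1442708719 = _).
by move: (Z2R _ _) => L; rewrite lerBrDr.
Qed.

(** The mantissas 5/4 and 15/8 of [5 * k] give dyadic sums that differ by more than
[27e-6]. *)
Lemma fluctuation_osc e : (32 <= e)%N ->
  fluctuation (2 ^ e) + ln 2 * (27 / 10 ^+ 6) <= fluctuation (3 * 2 ^ e).
Proof.
move=> e32.
have e8 : (256 <= 2 ^ e)%N by rewrite (@leq_exp2l 2 8) //; lia.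
have e9 : (256 <= 3 * 2 ^ e)%N by lia.
rewrite !fluctuationE // -addrA (addrC (-1)) addrA -mulrDr lerD2r ler_pM2l ?ln2_gt0 //.
have gap : Z2R R 1442681214 + 27 * 10 ^+ 3 <= Z2R R 1442708713.
  rewrite -(Z2R_pow R 10 3) -[27]/(Z2R R 27) -Z2R_M -Z2R_D.
  by apply: Z2R_le; apply/Z.leb_le; vm_compute.
move: (Z2R _ _) (Z2R _ _) (limit_sum_5_4 e32) (limit_sum_15_8 e32) gap; clear.
move: (limit_sum _ _) (limit_sum _ _) => g1 g2 A B; lra.
Qed.

Lemma fluctuation_not_cvg : ~ cvgn fluctuation.
Proof.
move=> /cvg_ex[/= L] /cvgrPdist_lt/(_ (ln 2 * (13 / 10 ^+ 6))).
have l0 : 0 < ln 2 * (13 / 10 ^+ 6) :> R by rewrite mulr_gt0 ?ln2_gt0 // divr_gt0 ?exprn_gt0.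
move=> /(_ l0) [N _ HN].
pose e := (N + 32)%N; have e32 : (32 <= e)%N by exact: leq_addl.
have eN : (N <= 2 ^ e)%N.
  by apply: ltnW; apply: leq_ltn_trans (ltn_expl e (ltnSn 1)); exact: leq_addr.
have := HN _ eN; have := HN (3 * 2 ^ e)%N (leq_trans eN (leq_pmull _ _)) => /=.
have := fluctuation_osc e32; rewrite !ltr_norml => A /(_ isT)/andP[B C] /andP[D E].
have := ln2_gt0; lra.
Qed.

Lemma ratio_error k e : (256 <= k)%N -> (5 <= e)%N -> (2 ^ e <= k < 2 ^ e.+1)%N ->
  `|1 - (d2 (2 ^ k - 3)%N)%:R / (2 ^+ k / (5 * k%:R * ln 2) * (1 + fluctuation k))|
    <= 2 ^+ 28 * 100 / e%:R.
Proof.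
move=> k256 e5 ek; have k0 : 0 < k%:R :> R by rewrite ltr0n; lia.
have err := @scaled_d2_error R e k e5 ek.
have l0 := ln2_gt0; have P0 : 0 < 2 ^+ k :> R by rewrite exprn_gt0.
have := limit_sum_ln2 k256; rewrite ltr_norml => /andP[g1 _].
have l1 : ln 2 <= 1 :> R by have := @le_ln1Dx R 1 ltac:(lra).
have half : 10 ^- 5 <= 1 / 2 :> R by lra.
have g0 : 1 / 2 <= limit_sum R k.
  have h : 1 / 2 <= ln 2 * limit_sum R k by lra.
  rewrite leNgt; apply/negP => lt; nra.
have gp : 0 < limit_sum R k by lra.
have -> : 1 + fluctuation k = ln 2 * limit_sum R k.
  by rewrite fluctuationE //; ring.
have -> : 1 - (d2 (2 ^ k - 3))%:R / (2 ^+ k / (5 * k%:R * ln 2) * (ln 2 * limit_sum R k))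
   = - (scaled_d2 R k - limit_sum R k) / limit_sum R k.
  by rewrite /scaled_d2; field; rewrite ?gt_eqF.
rewrite normrM normrN normfV (gtr0_norm gp) ler_pdivrMr //.
apply: (le_trans err).
have e0 : 0 < e%:R :> R by rewrite ltr0n; lia.
have kk : (2 * e%:R + 5) ^+ 2 / k%:R <= 100 / e%:R :> R.
  apply: le_trans (error_tends e5); rewrite ler_wpM2l ?sqr_ge0 //.
  case/andP: ek => ek _.
  by rewrite lef_pV2 ?posrE ?exprn_gt0 // -natrX ler_nat.
have b0 : 0 <= 100 / e%:R :> R by rewrite divr_ge0.
have -> : 2 ^+ 28 * 100 / e%:R = 2 * (100 / e%:R * 2 ^+ 27) :> R by rewrite (exprS _ 27); ring.
rewrite mulrAC.
have q0 : 0 <= 2 ^+ 27 :> R by rewrite exprn_ge0.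
apply: le_trans (ler_wpM2r q0 kk) _.
move: (100 / e%:R) b0 (2 ^+ 27) q0 => b b0 q q0.
have : b * q <= 2 * (b * q) * limit_sum R k by rewrite mulrAC ler_peMl ?mulr_ge0 //; lra.
lra.
Qed.
End Final.

Unset Implicit Arguments.

Theorem theorem19 (R : realType) :
  exists Theta : nat -> R,
    [/\ oscillating Theta,
        (forall k : nat, `|Theta k| < 10 ^- 5) &
        ((d2 (2 ^ k - 3)%N)%:R
           / (2 ^+ k / (5 * k%:R * ln 2) * (1 + Theta k))) @[k --> \oo]
          --> (1 : R)].
Proof.
exists (fluctuation R); split; [split| |].
- exists 1; split => // M M1 k _ /=; apply: le_trans (ltW M1).
  apply: ltW; apply: lt_le_trans (fluctuation_small R k) _; lra.
- exact: fluctuation_not_cvg.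
- exact: fluctuation_small.
apply/cvgrPdist_le => eps eps0.
(* Beyond [2 ^ E], the error [2 ^ 28 * 100 / e] is at most [eps]. *)
pose E := (Num.truncn ((2 ^+ 28 * 100 / eps : R)) + 32)%N.
exists (2 ^ E)%N => // k /= Ek.
have E32 : (32 <= E)%N by exact: leq_addl.
have k256 : (256 <= k)%N by apply: leq_trans Ek; rewrite (@leq_exp2l 2 8) //; lia.
have /andP[k1 k2] := trunc_log_bounds (isT : (1 < 2)%N) (leq_trans (isT : 0 < 256)%N k256).
set e := trunc_log 2 k in k1 k2.
have Ee : (E <= e)%N.
  by rewrite -ltnS -(ltn_exp2l _ _ (isT : (1 < 2)%N)) (leq_ltn_trans Ek).
have e5 : (5 <= e)%N by lia.
apply: le_trans (ratio_error R k256 e5 _) _; first by rewrite k1 k2.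
have e0 : 0 < e%:R :> R by rewrite ltr0n; lia.
have c0 : 0 <= 2 ^+ 28 * 100 / eps :> R by rewrite divr_ge0 ?(ltW eps0) // mulr_ge0 // exprn_ge0.
have /andP[_ tr] := truncn_itv c0.
have : 2 ^+ 28 * 100 / eps <= e%:R :> R.
  by apply: (le_trans (ltW tr)); rewrite ler_nat; move: Ee; rewrite /E; lia.
by rewrite ler_pdivrMr // => tr'; rewrite ler_pdivrMr // [leRHS]mulrC.
Qed.
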